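(* Let $P_0=\begin{pmatrix} q & s\\ s & r\end{pmatrix}\in\mathbb{S}^2$ with $r\le 0$ and let $$\mathbf{V}=\left\{vI_k \;\middle|\; v\in\mathbb{C},\ \begin{pmatrix}1\\ v\end{pmatrix}^{*}P_0\begin{pmatrix}1\\ v\end{pmatrix}\ge 0\right\}.$$ Let $\begin{pmatrix}A_\psi&B_\psi\\ C_\psi&D_\psi\end{pmatrix}\in\mathbb{R}^{(n_\psi+m_\psi)\times(n_\psi+k)}$ with $A_\psi\in\mathbb{R}^{n_\psi\times n_\psi}$ stable (Hurwitz) be given and abbreviate $J_\Psi:=\mathrm{diag}(J_\psi,J_\psi)$ for $J\in\{A,B,C,D\}$. Then the uncertain interconnection $$\begin{pmatrix}\dot x(t)\\ z(t)\end{pmatrix}=\begin{pmatrix}A&B\\ C&D\end{pmatrix}\begin{pmatrix}x(t)\\ w(t)\end{pmatrix},\quad w(t)=\Delta(z)(t),\quad t\ge0,\quad \Delta\in\mathbf{\Delta}(\mathbf{V}),$$ is robustly stable if there exist $X\in\mathbb{S}^{2n_\psi+n}$, $Y\in\mathbb{S}^{n_\psi}$ and $M\in\mathbb{S}^{m_\psi}$ satisfying $$\begin{pmatrix} I&0\\ A_\psi&B_\psi\end{pmatrix}^T\begin{pmatrix}0&Y\\ Y&0\end{pmatrix}\begin{pmatrix} I&0\\ A_\psi&B_\psi\end{pmatrix}+\begin{pmatrix}C_\psi&D_\psi\end{pmatrix}^TM\begin{pmatrix}C_\psi&D_\psi\end{pmatrix}\succ0,$$ $$H^T\begin{pmatrix}0&X&0\\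 X&0&0\\ 0&0&P_0\otimes M\end{pmatrix}H\prec0\quad\text{with}\quad H=\begin{pmatrix}I&0&0\\ 0&I&0\\ A_\Psi&B_\Psi\begin{pmatrix}C\\ 0\end{pmatrix}&B_\Psi\begin{pmatrix}D\\ I_k\end{pmatrix}\\ 0&A&B\\ C_\Psi&D_\Psi\begin{pmatrix}C\\ 0\end{pmatrix}&D_\Psi\begin{pmatrix}D\\ I_k\end{pmatrix}\end{pmatrix},$$ and $$X-\begin{pmatrix}P_0\otimes Y&0\\ 0&0\end{pmatrix}\succ0.$$
   Context: $\mathbb{S}^n$ is the set of real symmetric $n\times n$ matrices; $\otimes$ is the Kronecker product; ${}^*$ is the conjugate transpose; $L_{2e}^n$ is the space of locally square integrable functions $[0,\infty)\to\mathbb{R}^n$; $\mathrm{RH}_\infty^{m\times n}$ is the space of real rational $m\times n$ matrices without poles in the extended closed right half-plane. $A\in\mathbb{R}^{n\times n}$, $B\in\mathbb{R}^{n\times l}$, $C\in\mathbb{R}^{k\times n}$, $D\in\mathbb{R}^{k\times l}$ are given real matrices (here $l=k$). Uncertainties: $\Delta$ is a stable LTI system with input-output map $\Delta:L_{2e}^k\to L_{2e}^l$, $$\Delta(z)(t)=\int_0^tC_\Delta e^{A_\Delta(t-s)}B_\Delta z(s)\,ds+D_\Delta z(t),$$ for some real matrices $A_\Delta,B_\Delta,C_\Delta,D_\Delta$. The same symbol denotes its transfer matrix $\Delta(s)=C_\Delta(sI-A_\Delta)^{-1}B_\Delta+D_\Delta$; stability means $\Delta\in\mathrm{RH}_\infty^{l\times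 k}$. For $\mathbf{V}\subset\mathbb{C}^{l\times k}$, $\mathbf{\Delta}(\mathbf{V})$ is the set of all such $\Delta$ with $\Delta(i\omega)\in\mathbf{V}$ for all $\omega\in\mathbb{R}\cup\{\infty\}$. Robust stability: the interconnection is robustly stable if it is well-posed, i.e., $\det(I-DV)\ne0$ for all $V\in\mathbf{V}$, and if there exists a constant $M_0>0$ such that the state-trajectories satisfy $\lim_{t\to\infty}x(t)=0$ and $\|x(t)\|\le M_0\|x(0)\|$ for all $t\ge0$, for all initial conditions $x(0)\in\mathbb{R}^n$ and any $\Delta\in\mathbf{\Delta}(\mathbf{V})$. *)

(* Defs.v *)
From HB Require Import structures.
From mathcomp Require Import all_boot all_order all_algebra.
From mathcomp Require Import complex.
From mathcomp Require Import all_classical all_reals all_analysis.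

Set Implicit Arguments.
Unset Strict Implicit.
Unset Printing Implicit Defensive.

Import Order.TTheory GRing.Theory Num.Theory.
Import numFieldNormedType.Exports.

#[global] Open Scope classical_set_scope.
#[global] Open Scope ring_scope.

Definition cmx (R : realType) (m n : nat) (A : 'M[R]_(m, n)) : 'M[R[i]]_(m, n) :=
  map_mx (real_complex R) A.

Definition posdef (R : realType) (n : nat) (M : 'M[R]_n) : Prop :=
  M^T = M /\ forall u : 'cV[R]_n, u != 0 -> 0 < (u^T *m M *m u) ord0 ord0.

Definition negdef (R : realType) (n : nat) (M : 'M[R]_n) : Prop :=
  posdef (- M).

Definition hurwitz (R : realType) (n : nat) (A : 'M[R]_n) : Prop :=
  forall lam : R[i], eigenvalue (cmx A) lam -> complex.Re lam < 0.

(* Euclidean norm; the norm `|_| that the library puts on matrices is the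
   maximum norm. *)
Definition enorm (R : realType) (n : nat) (x : 'cV[R]_n) : R :=
  Num.sqrt (\sum_(i < n) x i ord0 ^+ 2).

Definition bdiag2 (R : realType) (m n : nat) (J : 'M[R]_(m, n)) :
    'M[R]_(m + m, n + n) :=
  block_mx J 0 0 J.

Definition sym2 (R : realType) (q s r : R) : 'M[R]_(1 + 1) :=
  block_mx (q%:M : 'M[R]_1) (s%:M : 'M[R]_1) (s%:M : 'M[R]_1) (r%:M : 'M[R]_1).

(* The Kronecker product of P and M, for a left factor P of size 2 x 2.  It is
   written blockwise so that its row and column types are those of bdiag2. *)
Definition kron2 (R : realType) (m n : nat) (P : 'M[R]_(1 + 1)) (M : 'M[R]_(m, n)) :
    'M[R]_(m + m, n + n) :=
  block_mx (P ord0 ord0 *: M) (P ord0 ord_max *: M)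
           (P ord_max ord0 *: M) (P ord_max ord_max *: M).

Definition expmx (R : realType) (n : nat) (A : 'M[R]_n) : 'M[R]_n :=
  \matrix_(i < n, j < n)
    limn (series (fun p : nat => (p`!%:R)^-1 * (A ^+ p) i j)).

Definition vint (R : realType) (n : nat) (a b : R) (f : R -> 'cV[R]_n) :
    'cV[R]_n :=
  \col_(i < n) \int[lebesgue_measure]_(t in `[a, b]) f t i ord0.

(* Signals on [0, +oo[ are functions on R whose values at negative times are
   never looked at. *)
Definition L2e (R : realType) (n : nat) (z : R -> 'cV[R]_n) : Prop :=
  forall i : 'I_n,
    measurable_fun (`[0, +oo[ : set R) (fun t : R => z t i ord0) /\
    forall T : R, 0 <= T ->
      lebesgue_measure.-integrable `[0, T] (fun t : R => (z t i ord0 ^+ 2)%:E).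

(* x is locally absolutely continuous on [0, +oo[ with derivative v almost
   everywhere, stated as x being an indefinite integral of the locally
   integrable function v. *)
Definition ac_derivative (R : realType) (n : nat) (x v : R -> 'cV[R]_n) : Prop :=
  (forall (i : 'I_n) (T : R), 0 <= T ->
     lebesgue_measure.-integrable `[0, T] (fun t : R => (v t i ord0)%:E)) /\
  (forall t : R, 0 <= t -> x t = x 0 + vint 0 t v).

(* Numerator and denominator of a real rational function in lowest terms, up to
   a common nonzero constant factor. *)
Definition rnum (R : realType) (f : {fraction {poly R}}) : {poly R} :=
  (frac (repr f)).1 %/ gcdp (frac (repr f)).1 (frac (repr f)).2.

Definition rden (R : realType) (f : {fraction {poly R}}) : {poly R} :=
  (frac (repr f)).2 %/ gcdp (frac (repr f)).1 (frac (repr f)).2.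

Definition pole (R : realType) (f : {fraction {poly R}}) (lam : R[i]) : Prop :=
  root (map_poly (real_complex R) (rden f)) lam.

Definition pole_infty (R : realType) (f : {fraction {poly R}}) : Prop :=
  (size (rden f) < size (rnum f))%N.

Definition rat_eval (R : realType) (f : {fraction {poly R}}) (lam : R[i]) :
    R[i] :=
  (map_poly (real_complex R) (rnum f)).[lam] /
  (map_poly (real_complex R) (rden f)).[lam].

(* Limit at infinity of a rational function without pole at infinity. *)
Definition rat_eval_infty (R : realType) (f : {fraction {poly R}}) : R[i] :=
  real_complex R ((rnum f)`_(size (rden f)).-1 / lead_coef (rden f)).

Definition RHinf (R : realType) (m n : nat)
    (G : 'M[{fraction {poly R}}]_(m, n)) : Prop :=
  forall (i : 'I_m) (j : 'I_n),
    (forall lam : R[i], 0 <= complex.Re lam -> ~ pole (G i j) lam) /\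
    ~ pole_infty (G i j).

Record lti (R : realType) (l k : nat) := Lti {
  lti_dim : nat;
  lti_A : 'M[R]_lti_dim;
  lti_B : 'M[R]_(lti_dim, k);
  lti_C : 'M[R]_(l, lti_dim);
  lti_D : 'M[R]_(l, k) }.

Definition lti_map (R : realType) (l k : nat) (Delta : lti R l k)
    (z : R -> 'cV[R]_k) (t : R) : 'cV[R]_l :=
  vint 0 t (fun s : R =>
    lti_C Delta *m expmx ((t - s) *: lti_A Delta) *m lti_B Delta *m z s)
  + lti_D Delta *m z t.

(* C (s I - A)^-1 B + D over the field R(s) of real rational functions. *)
Definition transfer (R : realType) (l k : nat) (Delta : lti R l k) :
    'M[{fraction {poly R}}]_(l, k) :=
  let F := fun c : R => tofrac c%:P in
  map_mx F (lti_C Delta)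
    *m invmx ((tofrac 'X)%:M - map_mx F (lti_A Delta))
    *m map_mx F (lti_B Delta)
  + map_mx F (lti_D Delta).

(* Delta(i w) is read as the value of the rational matrix Delta(s), in which
   hidden imaginary modes of the realization have cancelled. *)
Definition uncertainties (R : realType) (l k : nat) (V : set 'M[R[i]]_(l, k)) :
    set (lti R l k) :=
  [set Delta | RHinf (transfer Delta) /\
    (forall w : R,
       V (map_mx (fun f => rat_eval f (Complex 0 w)) (transfer Delta))) /\
    V (map_mx (@rat_eval_infty R) (transfer Delta))].

Definition trajectory (R : realType) (n l k : nat)
    (A : 'M[R]_n) (B : 'M[R]_(n, l)) (C : 'M[R]_(k, n)) (D : 'M[R]_(k, l))
    (Delta : lti R l k) (x : R -> 'cV[R]_n) : Prop :=
  exists (dx : R -> 'cV[R]_n) (w : R -> 'cV[R]_l) (z : R -> 'cV[R]_k),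
    L2e z /\ ac_derivative x dx /\
    {ae lebesgue_measure, forall t : R, 0 <= t ->
       col_mx (dx t) (z t) = block_mx A B C D *m col_mx (x t) (w t) /\
       w t = lti_map Delta z t}.

Definition robustly_stable (R : realType) (n l k : nat)
    (A : 'M[R]_n) (B : 'M[R]_(n, l)) (C : 'M[R]_(k, n)) (D : 'M[R]_(k, l))
    (V : set 'M[R[i]]_(l, k)) : Prop :=
  (forall W, V W -> \det (1%:M - cmx D *m W) != 0) /\
  exists M0 : R, 0 < M0 /\
    forall Delta : lti R l k, uncertainties V Delta ->
    forall x : R -> 'cV[R]_n, trajectory A B C D Delta x ->
      (x t @[t --> +oo] --> (0 : 'cV[R]_n)) /\
      forall t : R, 0 <= t -> enorm (x t) <= M0 * enorm (x 0).

(* In the order of R[i], 0 <= a means that a is real and nonnegative. *)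
Definition repeated_scalars (R : realType) (k : nat) (P : 'M[R]_(1 + 1)) :
    set 'M[R[i]]_k :=
  [set W | exists v : R[i], W = v%:M /\
    let e := col_mx (1%:M : 'M[R[i]]_1) (v%:M : 'M[R[i]]_1) in
    0 <= ((map_mx Num.conj e^T) *m cmx P *m e) ord0 ord0].

Definition lmi_H (R : realType) (n k np mp : nat)
    (A : 'M[R]_n) (B : 'M[R]_(n, k)) (C : 'M[R]_(k, n)) (D : 'M[R]_k)
    (Ap : 'M[R]_np) (Bp : 'M[R]_(np, k)) (Cp : 'M[R]_(mp, np))
    (Dp : 'M[R]_(mp, k)) :
    'M[R]_((np + np + n) + (np + np + n) + (mp + mp), np + np + n + k) :=
  let AP := bdiag2 Ap in let BP := bdiag2 Bp in
  let CP := bdiag2 Cp in let DP := bdiag2 Dp in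
  col_mx
    (col_mx
      (col_mx (row_mx (row_mx 1%:M 0) 0)
              (row_mx (row_mx 0 1%:M) 0))
      (col_mx (row_mx (row_mx AP (BP *m col_mx C 0)) (BP *m col_mx D 1%:M))
              (row_mx (row_mx 0 A) B)))
    (row_mx (row_mx CP (DP *m col_mx C 0)) (DP *m col_mx D 1%:M)).
Arguments repeated_scalars {R} k P _.

(* Main.v *)
Require Import Defs.
From HB Require Import structures.
From mathcomp Require Import all_boot all_order all_algebra.
From mathcomp Require Import complex.
From mathcomp Require Import all_classical all_reals all_analysis.
From mathcomp Require Import measurable_realfun.
From mathcomp Require Import ring lra zify.

Set Implicit Arguments.
Unset Strict Implicit.
Unset Printing Implicit Defensive.

Import Order.TTheory GRing.Theory Num.Theory.
Import numFieldNormedType.Exports.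
Local Open Scope ring_scope.

(** The frequency condition on delta is turned into a quadratic storage function
    for delta, and the three matrix inequalities turn that storage function into
    a Lyapunov function for the whole loop.

    An admissible Delta has the transfer matrix delta I with delta = b / a a
    stable scalar rational function satisfying
    q |a|^2 + 2 s Re(a^* b) + r |b|^2 >= 0 on the imaginary axis.  Spectral
    factorisation (spectral_factor) writes the left-hand side as |c|^2 for a real
    polynomial c.  Hence the polynomial in two variables
    q a(z)a(v) + s (a(z)b(v) + b(z)a(v)) + r b(z)b(v) - c(z)c(v) vanishes for
    v = - z, and dividing it by z + v (bezoutian) gives a quadratic form beta with
    q f^2 + 2 s f g + r g^2 = (c(d/dt) eta)^2 + d/dt beta(eta, eta', ...)
    whenever f = a(d/dt) eta and g = b(d/dt) eta (kyp_identity).  Since r <= 0 and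
    a is Hurwitz, beta decreases to 0 along every solution with f = 0, so beta is
    nonnegative.  The same holds with the square x^2 replaced by any positive
    definite form S applied to a vector of signals, coordinate by coordinate
    (storage_ge0).

    The possibly unstable or non-minimal realisation of Delta is replaced by k
    copies of the companion realisation of b / a: two realisations of the same
    transfer function have the same Markov parameters (transfer_markov), hence the
    same convolution kernel.  Along a trajectory this yields (trajectory_ode) a
    matrix K of k rows and N + 1 columns whose columns are successive derivatives
    of a partial state eta of delta, with z = a(d/dt) eta and w = b(d/dt) eta.

    Apply the filter psi to all columns of K at once.  As the filter commutes with
    d/dt, the filtered columns are again successive derivatives
    (filter_bank_state), so the filter states xi1 and xi2 driven by z and w are
    a(d/dt) and b(d/dt) of one and the same signal: xi2 = delta xi1.  Let S be the
    positive definite matrix of the first inequality.  It satisfies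
    d/dt (xi_i^T Y xi_j) + y_i^T M y_j = (xi_i, z_i)^T S (xi_j, z_j) for the two
    filters, with outputs y_1, y_2 and inputs z_1 = z, z_2 = w.  Therefore the
    storage of delta weighted by S, added to the form X - diag(P0 (x) Y, 0) in
    (xi1, xi2, x), has a derivative bounded by the second inequality
    (loop_storage).  The third inequality makes this sum bound |x|^2 from above,
    with constants that do not depend on Delta; its initial value only involves
    x(0), because the filters and delta start at rest.  Convergence of x to 0
    follows from the strict decrease (dissipated_cvg0). *)

(** * Spectral factorisation *)

Lemma horner_near_ge0 (R : realType) (p : {poly R}) (a e : R) :
  0 < e -> (forall x, a < x -> x < a + e -> 0 <= p.[x]) -> 0 <= p.[a].
Proof.
move=> e_gt0 p_ge0; rewrite leNgt; apply/negP => pa_lt0.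
have p_cont : horner p x @[x --> a^'+] --> p.[a].
  by apply: cvg_at_right_filter; exact: continuous_horner.
have : \forall x \near a^'+, p.[x] < 0 by exact: (cvgr_lt _ p_cont).
move=> neg; have : \forall x \near a^'+, False.
  near=> x.
  have : 0 <= p.[x].
    apply: p_ge0; first by near: x; exact: nbhs_right_gt.
    by near: x; apply: nbhs_right_lt; rewrite ltrDl.
  by apply/negP; rewrite -ltNge; near: x.
by move=> /filter_ex[].
Unshelve. all: by end_near.
Qed.

Lemma root_above_ge0 (R : realType) (p p1 : {poly R}) (a : R) :
  p = p1 * ('X - a%:P) -> (forall x, 0 <= x -> 0 <= p.[x]) ->
  forall x, 0 <= x -> a < x -> 0 <= p1.[x].
Proof.
move=> -> p_ge0 x x_ge0 ax; have := p_ge0 _ x_ge0.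
by rewrite hornerM hornerXsubC pmulr_lge0 // subr_gt0.
Qed.

(** The remainder of p modulo the real quadratic is c + d X; it also vanishes at
    a + i b, and b != 0 forces d = c = 0. *)
Lemma dvdp_quad_root (R : realType) (p : {poly R}) (a b : R) :
  b != 0 -> root (map_poly (real_complex R) p) (Complex a b) ->
  (('X - a%:P) ^+ 2 + (b ^+ 2)%:P) %| p.
Proof.
move=> b0; set f := _ + _ => /rootP pz.
have sf : size f = 3%N.
  rewrite size_polyDl size_exp_XsubC // size_polyC expf_eq0 /= (negPf b0) //.
have fz : (map_poly (real_complex R) f).[Complex a b] = 0.
  rewrite rmorphD rmorphXn /= map_polyXsubC map_polyC /= !hornerE.
  by rewrite expr2; simpc; congr Complex; ring.
have sr : (size (p %% f)%R <= 2)%N.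
  by rewrite -ltnS -sf ltn_modp -size_poly_gt0 sf.
have rz : (map_poly (real_complex R) (p %% f)).[Complex a b] = 0.
  by move: pz; rewrite {1}(divp_eq p f) rmorphD rmorphM /= !hornerE fz mulr0 add0r.
have def_r : p %% f = ((p %% f)`_0)%:P + (p %% f)`_1 *: 'X.
  apply/polyP => i; rewrite coefD coefC coefZ coefX.
  case: i => [|[|i]] /=; rewrite ?mulr0 ?mulr1 ?addr0 ?add0r //.
  by rewrite nth_default // (leq_trans sr).
move: rz; rewrite def_r rmorphD /= map_polyC map_polyZ map_polyX /= !hornerE.
simpc => -[E1 E2].
have c1 : (p %% f)`_1 = 0.
  by move/eqP: E2; rewrite mulf_eq0 (negPf b0) orbF => /eqP.
have c0 : (p %% f)`_0 = 0.
  by move: E1; rewrite c1 mul0r addr0.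
by rewrite /dvdp def_r c0 c1 scale0r addr0.
Qed.

Lemma spectral_factorM (R : comNzRingType) (f m g n : {poly R}) (t u : {poly R}) :
  f \Po t = m * (m \Po u) -> g \Po t = n * (n \Po u) ->
  (f * g) \Po t = (m * n) * ((m * n) \Po u).
Proof. by move=> fE gE; rewrite !comp_polyM fE gE; ring. Qed.

(** Substituting - X^2 for the variable moves the half-line x >= 0 to the imaginary
    axis.  Each root of p contributes one spectral factor: a real root is <= 0 or
    has even multiplicity, and the other roots come in conjugate pairs. *)
Lemma spectral_factor (R : realType) (p : {poly R}) :
  (forall x, 0 <= x -> 0 <= p.[x]) ->
  exists m : {poly R}, p \Po (- 'X^2) = m * (m \Po (- 'X)).
Proof.
have [n] := ubnP (size p); elim: n p => // n IHn p; rewrite ltnS => sp p_ge0.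
have [p0|p_neq0] := eqVneq p 0.
  by exists 0; rewrite p0 !comp_poly0 mul0r.
have [sp1|sp1] := leqP (size p) 1.
  have [c pE] : exists c, p = c%:P by exists p`_0; exact: size1_polyC.
  have c_ge0 : 0 <= c by have := p_ge0 0 (lexx _); rewrite pE hornerC.
  exists (Num.sqrt c)%:P.
  by rewrite pE !comp_polyC -polyCM -expr2 sqr_sqrtr.
have [[a b] z_root] : exists z, root (map_poly (real_complex R) p) z.
  by apply/closed_rootP; rewrite size_map_poly; case: (size p) sp1 => [|[]].
have [b0|b_neq0] := eqVneq b 0.
  have {}z_root : root p a.
    by move: z_root; rewrite b0 complexr0 fmorph_root.
  have [p1 pE] := factor_theorem p a z_root.
  have p1_neq0 : p1 != 0 by move: p_neq0; rewrite pE mulf_eq0 negb_or => /andP[].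
  have sp1E : size p = (size p1).+1.
    by rewrite pE size_Mmonic ?monicXsubC // size_XsubC addn2.
  have p1_ge0 := root_above_ge0 pE p_ge0.
  have [a_le0|a_gt0] := leP a 0.
    have [||m mE] := IHn p1; first by rewrite -ltnS -sp1E ltnS.
      move=> x; rewrite le_eqVlt => /predU1P[<-|x_gt0].
        apply: (horner_near_ge0 ltr01) => y y_gt0 _; apply: p1_ge0; first exact: ltW.
        exact: le_lt_trans y_gt0.
      by apply: p1_ge0; [exact: ltW|exact: le_lt_trans x_gt0].
    (* - X^2 - a = (c + X) (c - X) with c^2 = - a *)
    exists (m * ('X + (Num.sqrt (- a))%:P)); rewrite pE.
    apply: spectral_factorM => //.
    rewrite comp_polyB comp_polyD !comp_polyX !comp_polyC.
    have -> : a%:P = - ((Num.sqrt (- a))%:P ^+ 2).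
      by rewrite -rmorphXn /= sqr_sqrtr ?oppr_ge0 // polyCN opprK.
    by ring.
  have {}z_root : root p1 a.
    apply/rootP; apply/eqP; rewrite eq_le; apply/andP; split; last first.
      apply: (horner_near_ge0 ltr01) => x ax _; apply: p1_ge0 => //.
      exact: le_trans (ltW a_gt0) (ltW ax).
    rewrite -oppr_ge0 -hornerN.
    have := @horner_near_ge0 R (- (p1 \Po (- 'X))) (- a) a a_gt0.
    rewrite !hornerN horner_comp !hornerE opprK; apply=> x ax; rewrite addNr => x_lt0.
    rewrite hornerN horner_comp !hornerE oppr_ge0.
    have := p_ge0 (- x); rewrite oppr_ge0 => /(_ (ltW x_lt0)).
    by rewrite pE hornerM hornerXsubC nmulr_lge0 // subr_lt0 ltrNl.
  have [p2 p1E] := factor_theorem p1 a z_root.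
  have p2_ge0 : forall x, 0 <= x -> x != a -> 0 <= p2.[x].
    move=> x x_ge0 xa; have := p_ge0 x x_ge0.
    rewrite pE p1E -mulrA -expr2 hornerM horner_exp hornerXsubC pmulr_lge0 //.
    by rewrite exprn_even_gt0 //= subr_eq0.
  have p2_neq0 : p2 != 0 by move: p1_neq0; rewrite p1E mulf_eq0 negb_or => /andP[].
  have sp2E : size p1 = (size p2).+1.
    by rewrite p1E size_Mmonic ?monicXsubC // size_XsubC addn2.
  have [||m mE] := IHn p2.
  - by rewrite sp1E sp2E in sp; exact: leq_trans (ltnW _) sp.
  - move=> x x_ge0; have [->|] := eqVneq x a; last exact: p2_ge0.
    apply: (horner_near_ge0 ltr01) => y ay _; apply: p2_ge0; last by rewrite gt_eqF.
    exact: le_trans (ltW a_gt0) (ltW ay).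
  (* (- X^2 - a)^2 = (X^2 + a)^2, and X^2 + a is even. *)
  exists (m * ('X^2 + a%:P)); rewrite pE p1E -mulrA.
  apply: spectral_factorM => //.
  rewrite comp_polyM comp_polyB comp_polyD comp_Xn_poly !comp_polyX !comp_polyC.
  by ring.
have [p1 pE] := dvdpP _ _ (dvdp_quad_root b_neq0 z_root).
set f := _ + _ in pE.
have sf : size f = 3%N.
  by rewrite size_polyDl size_exp_XsubC // size_polyC expf_eq0 /= (negPf b_neq0).
have f_gt0 x : 0 < f.[x].
  rewrite hornerD horner_exp hornerXsubC hornerC ltr_wpDl ?sqr_ge0 //.
  by rewrite exprn_even_gt0.
have [p1_neq0 f_neq0] : p1 != 0 /\ f != 0.
  by move: p_neq0; rewrite pE mulf_eq0 negb_or => /andP[].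
have [||m mE] := IHn p1.
- have : size p = (size p1).+2 by rewrite pE size_mul // sf addn3.
  by move=> spE; rewrite spE in sp; exact: leq_trans (ltnW _) sp.
- by move=> x /p_ge0; rewrite pE hornerM pmulr_lge0.
(* (- X^2 - a)^2 + b^2 = (X^2 + h)^2 - c^2 X^2 with h = |a + i b| and
   c^2 = 2 (h - a). *)
pose h := Num.sqrt (a ^+ 2 + b ^+ 2).
have hE : h ^+ 2 = a ^+ 2 + b ^+ 2 by rewrite sqr_sqrtr // addr_ge0 ?sqr_ge0.
have ha : a <= h.
  rewrite (le_trans (ler_norm a)) // -sqrtr_sqr ler_sqrt ?addr_ge0 ?sqr_ge0 //.
  by rewrite lerDl sqr_ge0.
pose c := Num.sqrt (2 * (h - a)).
have cE : c ^+ 2 = 2 * (h - a) by rewrite sqr_sqrtr // mulr_ge0 ?subr_ge0.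
exists (m * ('X^2 + c *: 'X + h%:P)); rewrite pE.
apply: spectral_factorM => //.
have fE : f \Po (- 'X^2) = (- 'X^2 - a%:P) ^+ 2 + (b ^+ 2)%:P.
  by rewrite /f [X in X + _]expr2 comp_polyD comp_polyM comp_polyB comp_polyX !comp_polyC.
rewrite fE 2!comp_polyD comp_polyZ comp_Xn_poly comp_polyX comp_polyC.
have -> : (b ^+ 2)%:P = h%:P ^+ 2 - a%:P ^+ 2.
  by rewrite -!rmorphXn -rmorphB /= hE addrC addKr.
have cE' : c%:P ^+ 2 = 2 * (h%:P - a%:P).
  by rewrite -rmorphXn /= cE rmorphM rmorphB rmorph_nat.
rewrite -!mul_polyC.
transitivity ((- 'X^2 - a%:P) ^+ 2 + (h%:P ^+ 2 - a%:P ^+ 2)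
  + (2 * (h%:P - a%:P) - c%:P ^+ 2) * 'X^2).
  by rewrite cE' subrr mul0r addr0.
by ring.
Qed.

(** * The storage identity of a scalar transfer function *)

Lemma horner_imag_axis (R : realType) (p : {poly R}) (w : R) :
  (map_poly (real_complex R) p).[Complex 0 w] =
  Complex (even_poly p).[- w ^+ 2] (w * (odd_poly p).[- w ^+ 2]).
Proof.
have sq : (Complex 0 w) ^+ 2 = real_complex R (- w ^+ 2).
  by rewrite expr2; simpc; congr Complex; ring.
rewrite -[in LHS](poly_even_odd p) rmorphD rmorphM /= !map_comp_poly /=.
rewrite map_polyX map_polyXn !hornerE !horner_comp !hornerE sq.
by rewrite !horner_map /=; simpc; rewrite mulrC.
Qed.

(** With a(iw) = Ea + iw Oa and b(iw) = Eb + iw Ob, the left-hand side is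
    q |a|^2 + 2 s Re(a^* b) + r |b|^2 at iw: the condition defining the
    uncertainty set for the scalar delta = b / a, cleared of denominators. *)
Definition freq_ineq (R : realType) (q s r : R) (a b : {poly R}) : Prop :=
  forall w : R,
    let Ea := (even_poly a).[- w ^+ 2] in let Oa := (odd_poly a).[- w ^+ 2] in
    let Eb := (even_poly b).[- w ^+ 2] in let Ob := (odd_poly b).[- w ^+ 2] in
    0 <= q * (Ea ^+ 2 + w ^+ 2 * Oa ^+ 2) + 2 * s * (Ea * Eb + w ^+ 2 * (Oa * Ob))
         + r * (Eb ^+ 2 + w ^+ 2 * Ob ^+ 2).

(** The value at iw is q |a|^2 + 2 s Re(a^* b) + r |b|^2. *)
Definition para_form (R : realType) (q s r : R) (a b : {poly R}) : {poly R} :=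
  q *: (a * (a \Po (- 'X))) + s *: (a * (b \Po (- 'X)) + (a \Po (- 'X)) * b)
  + r *: (b * (b \Po (- 'X))).

(** The form is even, so it is p(- X^2) for a polynomial p, and freq_ineq says that
    p is nonnegative on the half-line.  The leading coefficient of m(X) m(- X)
    cannot cancel, which bounds the degree of m. *)
Lemma para_form_factor (R : realType) (q s r : R) (a b : {poly R}) (N : nat) :
  (size a <= N.+1)%N -> (size b <= N.+1)%N ->
  freq_ineq q s r a b ->
  exists2 m : {poly R}, (size m <= N.+1)%N & para_form q s r a b = m * (m \Po (- 'X)).
Proof.
move=> sa sb fdi.
pose e p := even_poly p \Po (- 'X) : {poly R}.
pose o p := odd_poly p \Po (- 'X) : {poly R}.
pose p := q *: (e a * e a + 'X * (o a * o a)) + (2 * s) *: (e a * e b + 'X * (o a * o b))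
          + r *: (e b * e b + 'X * (o b * o b)).
have [x x_ge0|m mE] := @spectral_factor R p.
  have := fdi (Num.sqrt x); rewrite sqr_sqrtr //=.
  by rewrite /p /e /o !hornerE !horner_comp !hornerE -!expr2.
have pE : p \Po (- 'X^2) = para_form q s r a b.
  have compN (t : {poly R}) : (- 'X) \Po t = - t.
    by rewrite -[- 'X]sub0r comp_polyB comp_poly0 comp_polyX sub0r.
  have eE (f : {poly R}) : e f \Po (- 'X^2) = even_poly f \Po 'X^2.
    by rewrite /e -comp_polyA compN opprK.
  have oE (f : {poly R}) : o f \Po (- 'X^2) = odd_poly f \Po 'X^2.
    by rewrite /o -comp_polyA compN opprK.
  have flip (f : {poly R}) : f \Po (- 'X) = (even_poly f \Po 'X^2) - (odd_poly f \Po 'X^2) * 'X.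
    have sq : 'X^2 \Po (- 'X) = 'X^2 :> {poly R} by rewrite comp_Xn_poly sqrrN.
    rewrite -[in LHS](poly_even_odd f) comp_polyD comp_polyM -!comp_polyA sq comp_polyX.
    by rewrite mulrN.
  rewrite /p !comp_polyD !comp_polyZ !comp_polyD.
  rewrite !comp_polyM !comp_polyX !eE !oE.
  rewrite /para_form !flip; move: (poly_even_odd a) (poly_even_odd b).
  set Ea := even_poly a \Po 'X^2; set Oa := odd_poly a \Po 'X^2.
  set Eb := even_poly b \Po 'X^2; set Ob := odd_poly b \Po 'X^2.
  move=> aE bE; rewrite -aE -bE.
  rewrite -!mul_polyC rmorphM rmorph_nat; ring.
exists m; last by rewrite -pE mE.
have [->|m_neq0] := eqVneq m 0; first by rewrite size_poly0.
have sX : size (- 'X : {poly R}) = 2%N by rewrite size_polyN size_polyX.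
have sc f : size (f \Po (- 'X) : {poly R}) = size f by rewrite size_comp_poly2.
have : (size (para_form q s r a b) <= N.*2.+1)%N.
  have sM (f g : {poly R}) : (size f <= N.+1)%N -> (size g <= N.+1)%N ->
      (size (f * g)%R <= N.*2.+1)%N.
    move=> sf sg; apply: leq_trans (size_polyMleq _ _) _; lia.
  have sD (f g : {poly R}) : (size f <= N.*2.+1)%N -> (size g <= N.*2.+1)%N ->
      (size (f + g)%R <= N.*2.+1)%N.
    by move=> sf sg; rewrite (leq_trans (size_polyD _ _)) // geq_max sf.
  rewrite /para_form; apply: (sD); first apply: (sD).
  - by apply: leq_trans (size_scale_leq _ _) _; apply: (sM); rewrite ?sc.
  - by apply: leq_trans (size_scale_leq _ _) _; apply: (sD); apply: (sM); rewrite ?sc.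
  - by apply: leq_trans (size_scale_leq _ _) _; apply: (sM); rewrite ?sc.
rewrite -pE mE size_mul //; last by rewrite comp_poly2_eq0.
by rewrite sc addnn; case: (size m) => [|n] //=; rewrite ltnS leq_double.
Qed.

(** init_rows forgets the last of N + 1 rows and tail_rows the first: if the rows
    are successive derivatives, tail_rows is the derivative of init_rows. *)
Definition init_rows (R : realType) (N : nat) : 'M[R]_(N, N.+1) :=
  \matrix_(i < N, j < N.+1) (j == i :> nat)%:R.

Definition tail_rows (R : realType) (N : nat) : 'M[R]_(N, N.+1) :=
  \matrix_(i < N, j < N.+1) (j == i.+1 :> nat)%:R.

Definition coef_col (R : realType) (N : nat) (p : {poly R}) : 'cV[R]_N.+1 :=
  \col_(i < N.+1) p`_i.

Arguments init_rows {R} N.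
Arguments tail_rows {R} N.

(** Partial alternating sum along the antidiagonal i + j, going down from (i, j);
    from (0, k) it is the coefficient of z^k in phi(- z, z). *)
Definition altsum (R : realType) (phi : nat -> nat -> R) (i j : nat) : R :=
  \sum_(l < j.+1) (-1) ^+ l * phi (i + l)%N (j - l)%N.

Lemma altsumS (R : realType) (phi : nat -> nat -> R) (i j : nat) :
  altsum phi i j.+1 = phi i j.+1 - altsum phi i.+1 j.
Proof.
rewrite /altsum big_ord_recl expr0 mul1r addn0 subn0; congr (_ + _).
rewrite -sumrN; apply: eq_bigr => l _; rewrite /bump /= exprD expr1 mulN1r mulNr.
by rewrite addnS addSn subSS.
Qed.

Lemma init_rowsE (R : realType) (N p : nat) (A : 'M[R]_(N.+1, p)) i j :
  (init_rows N *m A) i j = A (widen_ord (leqnSn N) i) j.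
Proof.
rewrite !mxE (bigD1 (widen_ord (leqnSn N) i)) //= mxE /= eqxx mul1r big1 ?addr0 // => k ki.
rewrite mxE; case: eqP => [E|]; rewrite ?mul0r //.
by case/eqP: ki; apply: val_inj.
Qed.

Lemma tail_rowsE (R : realType) (N p : nat) (A : 'M[R]_(N.+1, p)) i j :
  (tail_rows N *m A) i j = A (lift ord0 i) j.
Proof.
rewrite !mxE (bigD1 (lift ord0 i)) //= mxE /= eqxx mul1r big1 ?addr0 // => k ki.
rewrite mxE; case: eqP => [E|]; rewrite ?mul0r //.
by case/eqP: ki; apply: val_inj.
Qed.

Lemma tail_rows_trE (R : realType) (N p : nat) (A : 'M[R]_(N, p)) (f : nat -> 'I_p -> R) :
  (forall i j, A i j = f i j) -> forall i j,
  ((tail_rows N)^T *m A) i j = if i == 0 :> nat then 0 else f i.-1 j.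
Proof.
move=> Af i j; rewrite mxE; case: (unliftP ord0 i) => [k ->|->] /=; last first.
  by rewrite big1 // => l _; rewrite !mxE mul0r.
rewrite (bigD1 k) //= !mxE eqxx mul1r Af big1 ?addr0 // => l lk.
rewrite !mxE; case: eqP => [[E]|]; rewrite ?mul0r //.
by case/eqP: lk; apply: val_inj.
Qed.

Lemma init_rows_trE (R : realType) (N p : nat) (A : 'M[R]_(N, p)) (f : nat -> 'I_p -> R) :
  (forall i j, A i j = f i j) -> forall i j,
  ((init_rows N)^T *m A) i j = if i == N :> nat then 0 else f i j.
Proof.
move=> Af i j; rewrite mxE; case: (unliftP ord_max i) => [k ->|->] /=; last first.
  rewrite eqxx big1 // => l _; rewrite !mxE.
  by rewrite gtn_eqF /= ?mul0r.
have -> : (bump N k == N) = false by rewrite /bump leqNgt ltn_ord add0n ltn_eqF.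
have kE : bump N k = k by rewrite /bump leqNgt ltn_ord.
rewrite (bigD1 k) //= !mxE /= kE eqxx mul1r Af big1 ?addr0 // => l lk.
rewrite !mxE /= kE; case: eqP => [E|]; rewrite ?mul0r //.
by case/eqP: lk; apply: val_inj.
Qed.

(** Division of the polynomial phi(z, v) = sum phi_ij z^i v^j by z + v.  The
    coefficients of the quotient solve phi_ij = beta_(i-1)j + beta_i(j-1), which
    the alternating sums do; the hypothesis phi(- z, z) = 0 gives the equations on
    the boundary. *)
Lemma bezoutian (R : realType) (N : nat) (phi : nat -> nat -> R) :
  (forall i j, (N < i)%N || (N < j)%N -> phi i j = 0) ->
  (forall k, altsum phi 0 k = 0) ->
  exists beta : 'M[R]_N,
    (tail_rows N)^T *m beta *m init_rows N + (init_rows N)^T *m beta *m tail_rows N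
    = \matrix_(i < N.+1, j < N.+1) phi i j.
Proof.
move=> phi_out phi0; exists (\matrix_(i < N, j < N) altsum phi i.+1 j).
set beta := \matrix_(i, j) _.
(* All antidiagonal sums vanish, so the partial sums started at column N do. *)
have phiN i : (i <= N)%N -> altsum phi i N = 0.
  move=> iN; rewrite -[RHS](mulr0 ((-1) ^+ i)) -[in RHS](phi0 (i + N)%N) /altsum.
  rewrite -addnS big_split_ord /= [X in _ = _ * (X + _)]big1 ?add0r; last first.
    move=> l _; rewrite phi_out ?mulr0 //; apply/orP; right.
    by have := ltn_ord l; lia.
  rewrite mulr_sumr; apply: eq_bigr => l _.
  rewrite mulrA -exprD addnA exprD addnn -mul2n exprM sqrrN expr1n expr1n mul1r add0n.
  by rewrite subnDl.
pose f1 i (j : 'I_N.+1) := if j == N :> nat then 0 else altsum phi i.+1 j.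
pose f2 i (j : 'I_N.+1) := if j == 0 :> nat then 0 else altsum phi i.+1 j.-1.
have B1 : forall (i : 'I_N) j, (beta *m init_rows N) i j = f1 i j.
  move=> i j; rewrite (_ : (beta *m init_rows N) i j = (beta *m init_rows N)^T j i).
    rewrite trmx_mul (@init_rows_trE R N N _ (fun j i => altsum phi i.+1 j)) // => ? ?.
    by rewrite !mxE.
  by rewrite [RHS]mxE.
have B2 : forall (i : 'I_N) j, (beta *m tail_rows N) i j = f2 i j.
  move=> i j; rewrite (_ : (beta *m tail_rows N) i j = (beta *m tail_rows N)^T j i).
    rewrite trmx_mul (@tail_rows_trE R N N _ (fun j i => altsum phi i.+1 j)) // => ? ?.
    by rewrite !mxE.
  by rewrite [RHS]mxE.
apply/matrixP => i j; rewrite mxE -!mulmxA (tail_rows_trE B1) (init_rows_trE B2) mxE /f1 /f2.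
have := ltn_ord i; have := ltn_ord j; rewrite !ltnS.
case: i j => [i iN] [j jN] /= {}jN {}iN.
case: i iN => [|i] iN /=.
  rewrite add0r; case: j jN => [|j] jN /=.
    have := phi0 0%N; rewrite /altsum big_ord1 /= mul1r => ->.
    by rewrite if_same.
  rewrite ltn_eqF ?(leq_trans _ jN) //.
  by have := phi0 j.+1; rewrite altsumS => /eqP; rewrite subr_eq0 => /eqP.
have lift_i : altsum phi i.+1 j = phi i.+1 j - (if j == 0%N then 0 else altsum phi i.+2 j.-1).
  by case: j {jN} => [|j]; rewrite ?altsumS //= /altsum big_ord1 addn0 mul1r subr0.
have -> : (if j == N then 0 else altsum phi i.+1 j) = altsum phi i.+1 j.
  by case: eqP => // ->; rewrite phiN.
rewrite lift_i; case: (i.+1 =P N) => [->|_]; last by rewrite subrK.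
case: eqP => [_|/eqP j0]; first by rewrite subr0 addr0.
suff -> : altsum phi N.+1 j.-1 = 0 by rewrite subr0 addr0.
by rewrite /altsum big1 // => l _; rewrite phi_out ?mulr0 //; apply/orP; left; lia.
Qed.

(** For a trajectory h of derivatives (eta, eta', ..., eta^(N)), with input
    f = a(d/dt) eta and output g = b(d/dt) eta, this identity says that
    q f^2 + 2 s f g + r g^2 is (c(d/dt) eta)^2 plus the derivative of the
    quadratic form beta in (eta, ..., eta^(N-1)). *)
Definition lure_identity (R : realType) (N : nat) (q s r : R) (a b c : {poly R})
    (beta : 'M[R]_N) : Prop :=
  (tail_rows N)^T *m beta *m init_rows N + (init_rows N)^T *m beta *m tail_rows N
  = let A := coef_col N a in let B := coef_col N b in let C := coef_col N c in
    q *: (A *m A^T) + s *: (A *m B^T + B *m A^T) + r *: (B *m B^T) - C *m C^T.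

Lemma kyp_identity (R : realType) (q s r : R) (a b m : {poly R}) (N : nat) :
  (size a <= N.+1)%N -> (size b <= N.+1)%N -> (size m <= N.+1)%N ->
  para_form q s r a b = m * (m \Po (- 'X)) ->
  exists beta : 'M[R]_N, lure_identity q s r a b m beta.
Proof.
move=> sa sb sm factor.
pose phi i j := q * (a`_i * a`_j) + s * (a`_i * b`_j + b`_i * a`_j)
                + r * (b`_i * b`_j) - m`_i * m`_j.
have [||beta betaE] := @bezoutian R N phi.
- move=> i j; rewrite /phi => /orP[] Nj.
    by rewrite (nth_default _ (leq_trans sa Nj)) (nth_default _ (leq_trans sb Nj))
      (nth_default _ (leq_trans sm Nj)); ring.
  by rewrite (nth_default _ (leq_trans sa Nj)) (nth_default _ (leq_trans sb Nj))
      (nth_default _ (leq_trans sm Nj)); ring.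
- move=> k.
  have flip (f : {poly R}) i : (f \Po (- 'X))`_i = (-1) ^+ i * f`_i.
    rewrite coef_comp_poly -[in RHS](coefK f) coef_poly.
    under eq_bigr do rewrite -scaleN1r exprZn coefZ coefXn.
    have [fi|fi] := ltnP i (size f); last first.
      rewrite mulr0 big1 // => j _; case: eqP => [ij|_]; last by rewrite !mulr0.
      by have := ltn_ord j; rewrite -ij ltnNge fi.
    rewrite (bigD1 (Ordinal fi)) //= eqxx mulr1 big1 ?addr0 1?mulrC // => j ji.
    case: eqP => [ij|]; last by rewrite !mulr0.
    by case/eqP: ji; apply: val_inj; rewrite /= ij.
  have : (para_form q s r a b - m * (m \Po (- 'X)))`_k = 0.
    by rewrite factor subrr coef0.
  rewrite /para_form coefB !coefD !coefZ !coefD [(a \Po _) * b]mulrC !coefMr => <-.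
  rewrite -big_split /= !mulr_sumr -sumrN -!big_split /=.
  by apply: eq_bigr => l _; rewrite !flip /phi add0n; ring.
exists beta; rewrite /lure_identity betaE /=; apply/matrixP => i j.
by rewrite !mxE !big_ord1 !mxE /phi.
Qed.

(** * The companion realisation *)

(** The last row expresses eta^(N) through the lower derivatives when
    a(d/dt) eta = 0; with input f, last_unit f is added. *)
Definition ext_rows (R : realType) (N : nat) (a : {poly R}) : 'M[R]_(N.+1, N) :=
  \matrix_(i < N.+1, j < N) if i == N :> nat then - a`_j else (j == i :> nat)%:R.

Definition last_unit (R : realType) (N : nat) : 'cV[R]_N.+1 :=
  \col_(i < N.+1) (i == N :> nat)%:R.
Arguments last_unit {R} N.

Lemma ext_init_last (R : realType) (N : nat) (a : {poly R}) :
  a \is monic -> size a = N.+1 ->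
  ext_rows N a *m init_rows N + last_unit N *m (coef_col N a)^T = 1%:M.
Proof.
move=> /monicP a1 sa; have aN : a`_N = 1 by rewrite -a1 lead_coefE sa.
apply/matrixP => i j; rewrite !mxE big_ord1 !mxE.
case: (unliftP ord_max j) => [k ->|->] /=; last first.
  rewrite aN mulr1 big1 ?add0r; last first.
    by move=> l _; rewrite !mxE /= [N == _]gtn_eqF ?mulr0 ?ltn_ord.
  by [].
have kE : bump N k = k by rewrite /bump leqNgt ltn_ord.
rewrite kE (bigD1 k) //= !mxE /= kE eqxx mulr1 big1 ?addr0; last first.
  move=> l lk; rewrite !mxE /= kE; case: (k =P l :> nat) => [E|]; rewrite ?mulr0 //.
  by case/eqP: lk; apply: val_inj.
case: (i =P N :> nat) => [iN|iN]; first by rewrite mul1r addNr -val_eqE /= iN kE gtn_eqF.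
by rewrite mul0r addr0 -val_eqE /= kE eq_sym.
Qed.

Lemma init_ext (R : realType) (N : nat) (a : {poly R}) :
  init_rows N *m ext_rows N a = 1%:M.
Proof.
apply/matrixP => i j; rewrite init_rowsE !mxE /= ltn_eqF ?ltn_ord //.
by rewrite -val_eqE eq_sym.
Qed.

Lemma init_last (R : realType) (N : nat) : init_rows N *m last_unit N = 0 :> 'cV[R]_N.
Proof. by apply/matrixP => i j; rewrite init_rowsE !mxE /= ltn_eqF. Qed.

Lemma coef_last (R : realType) (N : nat) (p : {poly R}) :
  (coef_col N p)^T *m last_unit N = (p`_N)%:M.
Proof.
apply/matrixP => i j; rewrite !ord1 !mxE (bigD1 ord_max) //= !mxE eqxx !mulr1 big1 ?addr0 ?mulr1n //.
by move=> l lN; rewrite !mxE (negPf (_ : l != N :> nat)) ?mulr0.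
Qed.

Lemma coef_ext (R : realType) (N : nat) (a : {poly R}) :
  a \is monic -> size a = N.+1 -> (coef_col N a)^T *m ext_rows N a = 0.
Proof.
move=> a_monic sa; have aN : a`_N = 1 by move/monicP: a_monic; rewrite lead_coefE sa.
have := congr1 (mulmx^~ (ext_rows N a)) (ext_init_last a_monic sa).
rewrite mulmxDl -!mulmxA init_ext mulmx1 mul1mx.
move/(canRL (addKr _)); rewrite addNr => E.
have := congr1 (mulmx (coef_col N a)^T) E.
by rewrite mulmxA coef_last aN mul1mx mulmx0.
Qed.

Definition comp_A (R : realType) (N : nat) (a : {poly R}) : 'M[R]_N :=
  tail_rows N *m ext_rows N a.
Definition comp_B (R : realType) (N : nat) : 'cV[R]_N := tail_rows N *m last_unit N.
Definition comp_C (R : realType) (N : nat) (a b : {poly R}) : 'rV[R]_N :=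
  (coef_col N b)^T *m ext_rows N a.
Arguments comp_B {R} N.

Lemma char_poly_comp (R : realType) (N : nat) (a : {poly R}) :
  a \is monic -> size a = N.+1 -> char_poly (comp_A N a) = a.
Proof.
move=> a_monic sa; have NE : N = (size a).-1 by rewrite sa.
rewrite -[RHS]companionmxK //; subst N; congr char_poly.
apply/matrixP => i j; rewrite tail_rowsE !mxE /= /bump /= add1n.
have := ltn_ord i; case: (size a).-1 i j => [|d] i j /= ilt; first by case: i ilt.
by rewrite eqSS eq_sym [j == _ :> nat]eq_sym eq_sym.
Qed.

(** The vector (1, X, ..., X^(N-1)) is a times the resolvent of the companion
    matrix applied to its input column. *)
Definition powers_col (R : realType) (N : nat) : 'cV[{poly R}]_N := \col_(i < N) 'X^i.

Lemma init_powers (R : realType) (N : nat) :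
  map_mx polyC (init_rows N) *m powers_col R N.+1 = powers_col R N.
Proof.
apply/matrixP => i j; rewrite !mxE (bigD1 (widen_ord (leqnSn N) i)) //= !mxE /= eqxx mul1r.
rewrite big1 ?addr0 // => k ki; rewrite !mxE; case: eqP => [E|]; rewrite ?mul0r //.
by case/eqP: ki; apply: val_inj.
Qed.

Lemma tail_powers (R : realType) (N : nat) :
  map_mx polyC (tail_rows N) *m powers_col R N.+1 = 'X *: powers_col R N.
Proof.
apply/matrixP => i j; rewrite !mxE (bigD1 (lift ord0 i)) //= !mxE /= eqxx mul1r.
rewrite big1 ?addr0 ?exprS // => k ki; rewrite !mxE; case: eqP => [E|]; rewrite ?mul0r //.
by case/eqP: ki; apply: val_inj.
Qed.

Lemma coef_powers (R : realType) (N : nat) (p : {poly R}) : (size p <= N.+1)%N ->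
  map_mx polyC (coef_col N p)^T *m powers_col R N.+1 = p%:M.
Proof.
move=> sp; apply/matrixP => i j; rewrite !ord1 !mxE mulr1n -[RHS]coefK poly_def.
rewrite (big_ord_widen _ (fun i => p`_i *: 'X^i) sp) [RHS]big_mkcond /=.
apply: eq_bigr => k _; rewrite !mxE mul_polyC; case: ltnP => // pk.
by rewrite nth_default ?scale0r.
Qed.

Lemma powers_split (R : realType) (N : nat) (a : {poly R}) :
  a \is monic -> size a = N.+1 ->
  powers_col R N.+1 = map_mx polyC (ext_rows N a) *m powers_col R N
                      + a *: map_mx polyC (last_unit N).
Proof.
move=> a_monic sa; have := congr1 (map_mx polyC) (ext_init_last a_monic sa).
rewrite map_mxD !map_mxM map_mx1 => /(congr1 (mulmx^~ (powers_col R N.+1))).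
rewrite mul1mx mulmxDl -!mulmxA init_powers coef_powers ?sa // => <-.
by rewrite mul_mx_scalar.
Qed.

Lemma comp_resolvent (R : realType) (N : nat) (a : {poly R}) :
  a \is monic -> size a = N.+1 ->
  'X *: powers_col R N =
    map_mx polyC (comp_A N a) *m powers_col R N + a *: map_mx polyC (comp_B N).
Proof.
move=> a_monic sa; rewrite -tail_powers (powers_split a_monic sa) mulmxDr mulmxA.
by rewrite -scalemxAr -!map_mxM.
Qed.

Lemma comp_output (R : realType) (N : nat) (a b : {poly R}) :
  a \is monic -> size a = N.+1 -> (size b <= N.+1)%N ->
  (map_mx polyC (comp_C N a b) *m powers_col R N) ord0 ord0 + b`_N *: a = b.
Proof.
move=> a_monic sa sb; have := coef_powers sb.
rewrite (powers_split a_monic sa) mulmxDr mulmxA -scalemxAr -!map_mxM coef_last.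
move=> /matrixP/(_ ord0 ord0); rewrite mxE [X in _ + X]mxE.
by rewrite [in X in _ + X]mxE !mxE !mulr1n mulrC mul_polyC.
Qed.

(** A transfer function c (X - A)^-1 b + d that is zero has no Markov parameter.
    The rational function c A (X - A)^-1 b = X c (X - A)^-1 b - c b is again
    strictly proper, so c b = 0 and the argument repeats with c A in place of c.
    The vector v is chi (X - A)^-1 b. *)
Lemma markov_eq0 (R : realType) (n : nat) (A : 'M[R]_n) (b : 'cV[R]_n) (c : 'rV[R]_n)
    (d : R) (v : 'cV[{poly R}]_n) (chi : {poly R}) :
  'X *: v = map_mx polyC A *m v + chi *: map_mx polyC b ->
  chi != 0 -> (forall i, (size (v i ord0) < size chi)%N) ->
  (map_mx polyC c *m v) ord0 ord0 + d *: chi = 0 ->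
  d = 0 /\ forall p, c *m A ^+ p *m b = 0.
Proof.
move=> vE chi_neq0 sv.
have scv (u : 'rV[R]_n) : (size ((map_mx polyC u *m v) ord0 ord0) < size chi)%N.
  rewrite mxE (leq_ltn_trans (size_sum _ _ _)) //.
  rewrite -[X in (_ < X)%N]prednK ?size_poly_gt0 // ltnS.
  apply/bigmax_leqP => i _; rewrite mxE mul_polyC (leq_trans (size_scale_leq _ _)) //.
  by rewrite -ltnS prednK ?size_poly_gt0.
have proper (u : 'rV[R]_n) (e : R) :
    (map_mx polyC u *m v) ord0 ord0 + e *: chi = 0 -> e = 0.
  move=> E; apply/eqP; apply: contraTT (scv u) => e0.
  by move/eqP: E; rewrite addr_eq0 => /eqP ->; rewrite size_polyN size_scale // ltnn.
move=> cv; have d0 := proper _ _ cv; split=> // p.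
move: cv; rewrite d0 scale0r addr0 => {d0 d}.
have step (u : 'rV[R]_n) : (map_mx polyC u *m v) ord0 ord0 = 0 ->
    u *m b = 0 /\ (map_mx polyC (u *m A) *m v) ord0 ord0 = 0.
  move=> uv; have E : (map_mx polyC (u *m A) *m v) ord0 ord0 + (u *m b) ord0 ord0 *: chi = 0.
    have := congr1 (fun w => (map_mx polyC u *m w) ord0 ord0) vE.
    rewrite -scalemxAr mulmxDr mulmxA -map_mxM -scalemxAr -map_mxM.
    rewrite [in LHS]mxE uv mulr0 [X in _ = X]mxE [in X in _ = _ + X]mxE [in X in _ = _ + X]mxE.
    by rewrite [_ * _%:P]mulrC mul_polyC.
  have ub := proper _ _ E; split.
    by apply/matrixP => i j; rewrite !ord1 ub mxE.
  by rewrite -E ub scale0r addr0.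
elim: p c => [|p IHp] c cv; first by rewrite expr0 mulmx1; have [] := step _ cv.
by have [_ cAv] := step _ cv; rewrite exprS -[A * _]/(A *m _) mulmxA IHp.
Qed.

(** * Transfer matrices and Markov parameters *)

Lemma size_det_affine (R : realType) (n : nat) (A : 'M[{poly R}]_n) :
  (forall i j, (size (A i j) <= 2)%N) -> (size (\det A) <= n.+1)%N.
Proof.
move=> sA; apply: leq_trans (size_sum _ _ _) _; apply/bigmax_leqP => s _.
rewrite size_Msign -[n in X in (_ <= X)%N]card_ord -sum1_card (@big_mkcond nat) /=.
apply: (big_ind2 (fun (p : {poly R}) m => size p <= m.+1)%N) => [|p m q k sp sq|j _] //.
- by rewrite size_poly1.
- apply: leq_trans (size_polyMleq _ _) _.
  by rewrite -subn1 -addnS leq_subLR addnA leq_add.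
Qed.

Lemma size_adj_char_poly (R : realType) (n : nat) (A : 'M[R]_n) i j :
  (size ((\adj (char_poly_mx A)) i j) <= n)%N.
Proof.
case: n A i j => [|n] A i j; first by case: i.
rewrite mxE size_Msign; apply: size_det_affine => k l; rewrite !mxE.
case: (_ == _); rewrite ?mulr1n ?mulr0n; first by rewrite size_XsubC.
by rewrite sub0r size_polyN (leq_trans (size_polyC_leq1 _)).
Qed.

Lemma transfer_adj (R : realType) (l k : nat) (Delta : lti R l k) i j :
  tofrac (char_poly (lti_A Delta)) * transfer Delta i j =
  tofrac ((map_mx polyC (row i (lti_C Delta)) *m (\adj (char_poly_mx (lti_A Delta)) *m
             map_mx polyC (col j (lti_B Delta)))) ord0 ord0
          + lti_D Delta i j *: char_poly (lti_A Delta)).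
Proof.
case: Delta => n A B C D /=; rewrite /transfer /=.
set F := fun c : R => _.
have FE p q (M : 'M[R]_(p, q)) : map_mx F M = map_mx (@tofrac {poly R}) (map_mx polyC M).
  by rewrite -map_mx_comp.
have chi0 : tofrac (char_poly A) != 0.
  by rewrite tofrac_eq0 -size_poly_gt0 size_char_poly.
have invE : tofrac (char_poly A) *: invmx ((tofrac 'X)%:M - map_mx F A) =
    map_mx (@tofrac {poly R}) (\adj (char_poly_mx A)).
  have -> : (tofrac 'X)%:M - map_mx F A = map_mx (@tofrac {poly R}) (char_poly_mx A).
    by rewrite map_mxB map_scalar_mx FE.
  have det : \det (map_mx (@tofrac {poly R}) (char_poly_mx A)) = tofrac (char_poly A).
    by rewrite det_map_mx.
  have u : map_mx (@tofrac {poly R}) (char_poly_mx A) \in unitmx by rewrite unitmxE det unitfE.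
  by rewrite /invmx u det scalerA divff // scale1r map_mx_adj.
rewrite mxE mulrDr.
have -> (G : 'M[{fraction {poly R}}]_(l, k)) : tofrac (char_poly A) * G i j = (tofrac (char_poly A) *: G) i j.
  by rewrite [RHS]mxE.
rewrite scalemxAl scalemxAr invE !FE -!map_mxM.
rewrite -mulmxA !mxE -tofracM -tofracD; congr (tofrac (_ + _)).
  apply: eq_bigr => p _; rewrite !mxE; congr (_ * _).
  by apply: eq_bigr => r _; rewrite !mxE.
by rewrite mulrC mul_polyC.
Qed.

(** The difference of the two transfer functions is realised by the block diagonal
    system made of both, and it is zero. *)
Lemma transfer_markov (R : realType) (l k : nat) (Delta : lti R l k) i j (N : nat)
    (a b : {poly R}) :
  a \is monic -> size a = N.+1 -> (size b <= N.+1)%N ->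
  transfer Delta i j = tofrac b / tofrac a ->
  lti_D Delta i j = b`_N /\
  forall p, (lti_C Delta *m lti_A Delta ^+ p *m lti_B Delta) i j =
            (comp_C N a b *m comp_A N a ^+ p *m comp_B N) ord0 ord0.
Proof.
move=> a_monic sa sb tE.
set A1 := lti_A Delta; set chi := char_poly A1.
have a_neq0 : a != 0 := monic_neq0 a_monic.
have chi_neq0 : chi != 0 by rewrite -size_poly_gt0 size_char_poly.
pose v1 := \adj (char_poly_mx A1) *m map_mx polyC (col j (lti_B Delta)).
have v1E : 'X *: v1 = map_mx polyC A1 *m v1 + chi *: map_mx polyC (col j (lti_B Delta)).
  have : char_poly_mx A1 *m v1 = chi *: map_mx polyC (col j (lti_B Delta)).
    by rewrite mulmxA mul_mx_adj mul_scalar_mx.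
  by rewrite {1}/char_poly_mx mulmxBl mul_scalar_mx => <-; rewrite addrC subrK.
have num : a * ((map_mx polyC (row i (lti_C Delta)) *m v1) ord0 ord0 + lti_D Delta i j *: chi)
    = chi * b.
  apply/eqP; rewrite -tofrac_eq !tofracM -transfer_adj tE mulrCA [tofrac a * _]mulrC.
  by rewrite divfK // tofrac_eq0.
pose A := block_mx A1 0 0 (comp_A N a).
pose B := col_mx (col j (lti_B Delta)) (comp_B N).
pose C := row_mx (row i (lti_C Delta)) (- comp_C N a b).
pose v := col_mx (a *: v1) (chi *: powers_col R N).
have [||||d0 CAB] := @markov_eq0 R _ A B C (lti_D Delta i j - b`_N) v (a * chi).
- rewrite /A /B /v map_block_mx map_col_mx !map_mx0 mul_block_col !mul0mx addr0 add0r.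
  rewrite !scale_col_mx add_col_mx; congr col_mx.
    by rewrite scalerA ['X * _]mulrC -[(a * 'X) *: _]scalerA v1E scalerDr scalerA -scalemxAr.
  rewrite scalerA ['X * _]mulrC -[(chi * 'X) *: _]scalerA (comp_resolvent a_monic sa).
  by rewrite scalerDr scalerA -scalemxAr [chi * a]mulrC.
- exact: mulf_neq0.
- move=> q; rewrite /v.
  have sac : size (a * chi) = (N.+1 + lti_dim Delta)%N.
    by rewrite size_mul // sa size_char_poly addnS.
  case: (split_ordP q) => r ->; rewrite ?col_mxEu ?col_mxEd mxE sac.
    apply: leq_ltn_trans (size_polyMleq _ _) _; rewrite sa addSn /= ltnS.
    rewrite leq_add2l mxE.
    apply: leq_trans (size_sum _ _ _) _; apply/bigmax_leqP => t _.
    rewrite [map_mx _ _ _ _]mxE mulrC mul_polyC (leq_trans (size_scale_leq _ _)) //.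
    exact: size_adj_char_poly.
  apply: leq_ltn_trans (size_polyMleq _ _) _; rewrite size_char_poly !mxE size_polyXn.
  by rewrite addSn /= [ltnRHS]addnC ltn_add2l ltnS ltn_ord.
- have sE (f : {poly R}) (G : 'M[{poly R}]_1) : (f *: G) ord0 ord0 = f * G ord0 ord0.
    by rewrite mxE.
  have nE (G : 'M[{poly R}]_1) : (- G) ord0 ord0 = - G ord0 ord0 by rewrite mxE.
  rewrite /C /v map_row_mx mul_row_col mxE -!scalemxAr map_mxN mulNmx !sE nE.
  have := comp_output a_monic sa sb.
  set y := (_ *m powers_col R N) ord0 ord0; move=> yE.
  move: num; set z := (_ *m v1) ord0 ord0; rewrite -!mul_polyC polyCB => E.
  have {}yE : y = b - (b`_N)%:P * a by rewrite mul_polyC; exact: (canRL (addrK _) yE).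
  transitivity (a * (z + (lti_D Delta i j)%:P * chi) - chi * b); last by rewrite E subrr.
  by rewrite yE; ring.
split; first by apply/eqP; rewrite -subr_eq0 d0.
move=> p; have Ap : A ^+ p = block_mx (A1 ^+ p) 0 0 (comp_A N a ^+ p).
  elim: p => [|p IHp]; first by rewrite !expr0 -scalar_mx_block.
  rewrite !exprS IHp -[LHS]/(A *m _) /A mulmx_block !mulmx0 !mul0mx !addr0 !add0r.
  by [].
have := CAB p; rewrite Ap /C /B mul_row_block !mulmx0 addr0 add0r mul_row_col.
rewrite !mulNmx => /eqP; rewrite subr_eq0 => /eqP/matrixP/(_ ord0 ord0) <-.
by rewrite !mxE; apply: eq_bigr => t _; rewrite !mxE; congr (_ * _); apply: eq_bigr => ? _; rewrite !mxE.
Qed.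

(** * The scalar transfer function of an admissible uncertainty *)

Lemma rden_neq0 (R : realType) (f : {fraction {poly R}}) : rden f != 0.
Proof.
rewrite /rden dvdp_div_eq0 ?dvdp_gcdr //; exact: denom_ratioP.
Qed.

Lemma cancel_common_factor (F : fieldType) (x n d n' d' g : F) :
  x * d = n -> n = n' * g -> d = d' * g -> d != 0 -> x = n' / d'.
Proof.
move=> xd nE dE; rewrite dE mulf_eq0 negb_or => /andP[d'0 g0].
by apply/(canRL (mulfK d'0))/(mulIf g0); rewrite -mulrA -dE xd.
Qed.

Lemma frac_reduced (R : realType) (f : {fraction {poly R}}) :
  f = tofrac (rnum f) / tofrac (rden f).
Proof.
have d0 : (frac (repr f)).2 != 0 := denom_ratioP _.
set g := gcdp (frac (repr f)).1 (frac (repr f)).2.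
have E1 : tofrac (frac (repr f)).1 = tofrac (rnum f) * tofrac g.
  by rewrite -tofracM divpK // dvdp_gcdl.
have E2 : tofrac (frac (repr f)).2 = tofrac (rden f) * tofrac g.
  by rewrite -tofracM divpK // dvdp_gcdr.
apply: cancel_common_factor E1 E2 _; last by rewrite tofrac_eq0.
rewrite -[f in LHS]reprK !piE; apply/eqmodP; rewrite /= FracField.equivfE.
rewrite !numden_Ratio ?(oner_eq0, mulf_neq0, denom_ratioP) //.
by rewrite reprK !mulr1 mulrC.
Qed.

Lemma rnum0 (R : realType) : rnum (0 : {fraction {poly R}}) = 0.
Proof.
have /esym/eqP := frac_reduced (0 : {fraction {poly R}}).
by rewrite mulf_eq0 invr_eq0 !tofrac_eq0 (negPf (rden_neq0 _)) orbF => /eqP.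
Qed.

Lemma rden0 (R : realType) : rden (0 : {fraction {poly R}}) = 1.
Proof.
have /eqP := rnum0 R; rewrite /rnum /rden dvdp_div_eq0 ?dvdp_gcdl // => /eqP ->.
by rewrite gcd0p divpp // denom_ratioP.
Qed.

Lemma imag_axis_poly0 (R : realType) (p : {poly R}) :
  (forall w : R, (map_poly (real_complex R) p).[Complex 0 w] = 0) -> p = 0.
Proof.
move=> p0; apply/eqP; rewrite -(map_poly_eq0 (real_complex R)); apply/negPn/negP => p_neq0.
pose rs := [seq Complex 0 (n%:R : R) | n <- iota 0 (size p)].
have all_rs : all (root (map_poly (real_complex R) p)) rs.
  by apply/allP => z /mapP[n _ ->]; apply/rootP; exact: p0.
have uniq_rs : uniq rs.
  rewrite map_inj_uniq ?iota_uniq // => m n [] /eqP.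
  by rewrite eqr_nat => /eqP.
have := max_poly_roots p_neq0 all_rs uniq_rs.
by rewrite size_map size_iota size_map_poly ltnn.
Qed.

(** A polynomial that vanishes on the imaginary axis has infinitely many roots. *)
Lemma rat_eval_inj (R : realType) (f g : {fraction {poly R}}) :
  (forall w : R, ~ pole f (Complex 0 w)) -> (forall w : R, ~ pole g (Complex 0 w)) ->
  (forall w : R, rat_eval f (Complex 0 w) = rat_eval g (Complex 0 w)) -> f = g.
Proof.
move=> pf pg fg; have nz h w : ~ pole h (Complex 0 w) ->
    (map_poly (real_complex R) (rden h)).[Complex 0 w] != 0.
  by move=> ph; apply/eqP => h0; apply: ph; apply/rootP.
have E : rnum f * rden g - rnum g * rden f = 0.
  apply: imag_axis_poly0 => w; rewrite rmorphB !rmorphM /= !hornerE.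
  have := fg w; rewrite /rat_eval => /eqP.
  rewrite eqr_div ?nz // => /eqP ->; exact: subrr.
rewrite (frac_reduced f) (frac_reduced g); apply/eqP.
rewrite eqr_div ?tofrac_eq0 ?rden_neq0 // -!tofracM.
by move/eqP: E; rewrite subr_eq0 => /eqP ->.
Qed.

Lemma repeated_scalarsP (R : realType) (k : nat) (q s r : R) (W : 'M[R[i]]_k) :
  repeated_scalars k (sym2 q s r) W <->
  exists x y : R, W = (Complex x y)%:M /\ 0 <= q + 2 * s * x + r * (x ^+ 2 + y ^+ 2).
Proof.
have val (x y : R) (e := col_mx (1%:M : 'M[R[i]]_1) ((Complex x y)%:M : 'M[R[i]]_1)) :
    ((map_mx Num.conj e^T) *m cmx (sym2 q s r) *m e) ord0 ord0 =
    real_complex R (q + 2 * s * x + r * (x ^+ 2 + y ^+ 2)).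
  rewrite /e /cmx /sym2 map_block_mx tr_col_mx map_row_mx mul_row_block mul_row_col.
  rewrite !mxE !big_ord1 !mxE !big_ord1 !mxE !mulr1n rmorph1 !mul1r !mulr1.
  have -> : Num.conj (Complex x y) = Complex x (- y) by [].
  rewrite /real_complex_def; simpc; congr Complex; ring.
split=> [[[x y] [-> H]]|[x [y [-> H]]]].
  by exists x, y; split=> //; move: H; rewrite /= val ler0c.
by exists (Complex x y); split=> //=; rewrite val ler0c.
Qed.

Lemma freq_ineq_of_value (R : realType) (q s r : R) (a b : {poly R}) :
  (forall w : R, exists x y : R,
     (map_poly (real_complex R) b).[Complex 0 w] =
       Complex x y * (map_poly (real_complex R) a).[Complex 0 w] /\
     0 <= q + 2 * s * x + r * (x ^+ 2 + y ^+ 2)) ->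
  freq_ineq q s r a b.
Proof.
move=> H w; have [x [y [E ge0]]] := H w; move: E.
rewrite !horner_imag_axis; simpc => -[] /=.
set Ea := (even_poly a).[_]; set Oa := (odd_poly a).[_].
set Eb := (even_poly b).[_]; set Ob := (odd_poly b).[_] => EbE ObE.
have -> : w ^+ 2 * (Oa * Ob) = (w * Oa) * (w * Ob) by ring.
have -> : w ^+ 2 * Ob ^+ 2 = (w * Ob) ^+ 2 by ring.
rewrite EbE ObE.
have := mulr_ge0 ge0 (addr_ge0 (sqr_ge0 Ea) (sqr_ge0 (w * Oa))).
by congr (0 <= _); ring.
Qed.

(** All that the stability proof needs to know about Delta: its input-output map is
    that of k copies of the companion realisation of b / a. *)
Record scalar_realization (R : realType) (q s r : R) (k : nat) (Delta : lti R k k)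
    (N : nat) (a b : {poly R}) : Prop := ScalarRealization {
  sr_monic : a \is monic;
  sr_size_den : size a = N.+1;
  sr_size_num : (size b <= N.+1)%N;
  sr_stable : forall z, root (map_poly (real_complex R) a) z -> complex.Re z < 0;
  sr_freq : freq_ineq q s r a b;
  sr_infty : 0 <= q + 2 * s * b`_N + r * b`_N ^+ 2;
  sr_feed : lti_D Delta = (b`_N)%:M;
  sr_markov : forall p, lti_C Delta *m lti_A Delta ^+ p *m lti_B Delta =
     ((comp_C N a b *m comp_A N a ^+ p *m comp_B N) ord0 ord0)%:M }.

(** The off-diagonal entries vanish on the imaginary axis and the diagonal ones
    agree there, so the transfer matrix is scalar.  For k = 0 there is no entry to
    read delta from; any real point of the set serves as a constant delta, and
    r <= 0 ensures that the real part of an admissible v is admissible. *)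
Lemma uncertainty_realization (R : realType) (q s r : R) (k : nat) (Delta : lti R k k) :
  r <= 0 -> uncertainties (repeated_scalars k (sym2 q s r)) Delta ->
  exists N a b, scalar_realization q s r Delta N a b.
Proof.
move=> hr; case: k Delta => [|k] Delta [stable [onV atinf]].
  move/repeated_scalarsP: atinf => [x [y [_ xy]]].
  exists 0%N, 1, x%:P; split=> //.
  - exact: monic1.
  - by rewrite size_poly1.
  - exact: size_polyC_leq1.
  - by move=> z; rewrite rmorph1 /root hornerC oner_eq0.
  - apply: freq_ineq_of_value => w; exists x, 0; split.
      by rewrite map_polyC rmorph1 !hornerC mulr1.
    by apply: le_trans xy _; rewrite lerD2l expr0n addr0 ler_wnM2l // lerDl sqr_ge0.
  - rewrite coefC eqxx; apply: le_trans xy _.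
    by rewrite lerD2l ler_wnM2l // lerDl sqr_ge0.
  - by apply/matrixP => -[].
  - by move=> p; apply/matrixP => -[].
pose f := transfer Delta ord0 ord0.
have np i j (w : R) : ~ pole (transfer Delta i j) (Complex 0 w).
  by have [+ _] := stable i j; apply; rewrite /= lexx.
have offdiag i j : transfer Delta i j = if i == j then f else 0.
  have p0 (w : R) : ~ pole (0 : {fraction {poly R}}) (Complex 0 w).
    by rewrite /pole rden0 rmorph1 /root hornerC oner_eq0.
  have e0 (w : R) : rat_eval (0 : {fraction {poly R}}) (Complex 0 w) = 0.
    by rewrite /rat_eval rnum0 rmorph0 horner0 mul0r.
  apply: rat_eval_inj => // [w|w]; first by case: ifP => _; [exact: np|exact: p0].
  have [v [+ _]] := onV w => /matrixP Wv.
  have mE i' j' : rat_eval (transfer Delta i' j') (Complex 0 w) = v *+ (i' == j').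
    by have := Wv i' j'; rewrite [LHS]mxE [RHS]mxE.
  rewrite mE /f; case: eqP => _; rewrite ?mE ?e0 ?eqxx ?mulr1n ?mulr0n //.
pose c := ((lead_coef (rden f))^-1)%R.
have c0 : c != 0 by rewrite invr_eq0 lead_coef_eq0 rden_neq0.
pose a : {poly R} := c *: rden f; pose b : {poly R} := c *: rnum f.
have a0 : a != 0 by rewrite scaler_eq0 negb_or c0 rden_neq0.
have fE : f = tofrac b / tofrac a.
  rewrite [LHS]frac_reduced; apply/eqP.
  rewrite eqr_div ?tofrac_eq0 ?rden_neq0 // -!tofracM /a /b -!mul_polyC.
  by apply/eqP; congr tofrac; ring.
have sa : size a = (size a).-1.+1 by rewrite prednK // size_poly_gt0.
have a_monic : a \is monic by rewrite monicE lead_coefZ mulVf // lead_coef_eq0 rden_neq0.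
have sb : (size b <= size a)%N.
  rewrite !size_scale // leqNgt; apply/negP.
  by have [_] := stable ord0 ord0; rewrite /pole_infty.
have entry i j : transfer Delta i j = tofrac (if i == j then b else 0) / tofrac a.
  by rewrite offdiag; case: ifP => // _; rewrite tofrac0 mul0r.
have sbij (i j : 'I_k.+1) : (size (if i == j then b else 0)%R <= (size a).-1.+1)%N.
  by rewrite -sa; case: ifP; rewrite ?size_poly0.
have comp_C0 : comp_C (size a).-1 a 0 = 0.
  rewrite /comp_C (_ : coef_col _ 0 = 0) ?trmx0 ?mul0mx //.
  by apply/matrixP => i j; rewrite !mxE coef0.
exists (size a).-1, a, b; split=> //; first by rewrite -sa.
- move=> z za; rewrite ltNge; apply/negP => z_ge0.
  have [+ _] := stable ord0 ord0 => /(_ z z_ge0); apply; move: za.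
  by rewrite /pole /root map_polyZ hornerZ mulf_eq0 fmorph_eq0 (negPf c0).
- apply: freq_ineq_of_value => w; have := onV w.
  move/repeated_scalarsP => [x [y [/matrixP/(_ ord0 ord0) E xy]]]; exists x, y; split=> //.
  move: E; rewrite [LHS]mxE [RHS]mxE eqxx mulr1n => <-; rewrite /rat_eval -/f !map_polyZ /= !hornerZ.
  rewrite mulrCA divfK //; apply/eqP => h0.
  by apply: (np ord0 ord0 w); apply/rootP.
- move: atinf => /repeated_scalarsP[x [y [/matrixP/(_ ord0 ord0) E xy]]].
  have bN : b`_(size a).-1 = (rnum f)`_(size (rden f)).-1 / lead_coef (rden f).
    by rewrite /b /a coefZ size_scale // mulrC.
  move: E; rewrite [LHS]mxE [RHS]mxE eqxx mulr1n /rat_eval_infty -/f -bN => -[bx y0].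
  by move: xy; rewrite -bx -y0 expr0n addr0.
- apply/matrixP => i j; have [-> _] := transfer_markov a_monic sa (sbij i j) (entry i j).
  by rewrite mxE; case: eqP => //; rewrite coef0.
- move=> p; apply/matrixP => i j; have [_ ->] := transfer_markov a_monic sa (sbij i j) (entry i j).
  by rewrite [RHS]mxE; case: eqP => // _; rewrite comp_C0 !mul0mx mxE.
Qed.

(** * The matrix exponential *)

Definition entry_sum (R : realType) (m n : nat) (A : 'M[R]_(m, n)) : R :=
  \sum_i \sum_j `|A i j|.

Lemma entry_sum_ge0 (R : realType) (m n : nat) (A : 'M[R]_(m, n)) : 0 <= entry_sum A.
Proof. by apply: sumr_ge0 => i _; apply: sumr_ge0. Qed.

Lemma le_entry_sum (R : realType) (m n : nat) (A : 'M[R]_(m, n)) i j :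
  `|A i j| <= entry_sum A.
Proof.
rewrite /entry_sum (bigD1 i) //= (bigD1 j) //= -addrA lerDl addr_ge0 //.
  exact: sumr_ge0.
by apply: sumr_ge0 => k _; apply: sumr_ge0.
Qed.

Lemma entry_sumM (R : realType) (m n p : nat) (A : 'M[R]_(m, n)) (B : 'M[R]_(n, p)) :
  entry_sum (A *m B) <= entry_sum A * entry_sum B.
Proof.
rewrite /entry_sum mulr_suml; apply: ler_sum => i _.
apply: (@le_trans _ _ (\sum_j \sum_k `|A i k| * `|B k j|)).
  apply: ler_sum => j _; rewrite mxE (le_trans (ler_norm_sum _ _ _)) //.
  by apply: ler_sum => k _; rewrite normrM.
rewrite exchange_big /= mulr_suml; apply: ler_sum => k _.
rewrite -mulr_sumr ler_wpM2l //.
by rewrite [leRHS](bigD1 k) //= lerDl sumr_ge0 // => l _; apply: sumr_ge0.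
Qed.

(** Scalar power series c e^(xA) b: its formal derivative has the same form, which
    gives all the calculus of the matrix exponential. *)
Definition exp_coef (R : realType) (n : nat) (c : 'rV[R]_n) (A : 'M[R]_n) (b : 'cV[R]_n)
    (p : nat) : R :=
  (p`!%:R)^-1 * (c *m A ^+ p *m b) ord0 ord0.

Lemma exp_coef_diffs (R : realType) (n : nat) (c : 'rV[R]_n) (A : 'M[R]_n) (b : 'cV[R]_n) :
  pseries_diffs (exp_coef c A b) = exp_coef (c *m A) A b.
Proof.
apply/funext => p; rewrite /pseries_diffs /exp_coef factS natrM invfM mulrA mulrA.
by rewrite divff ?pnatr_eq0 // mul1r exprS -[A * _]/(A *m _) !mulmxA.
Qed.

Lemma is_cvg_exp_coef (R : realType) (n : nat) (c : 'rV[R]_n) (A : 'M[R]_n) (b : 'cV[R]_n)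
    (x : R) :
  cvgn (pseries (exp_coef c A b) x).
Proof.
apply: normed_cvg; rewrite /normed_series_of /=.
set m := entry_sum A * `|x|.
apply: (@series_le_cvg _ _ (fun p => (entry_sum c * entry_sum b) * exp_coeff m p)).
- by move=> p.
- move=> p; apply: mulr_ge0; first by rewrite mulr_ge0 ?entry_sum_ge0.
  by apply: exp_coeff_ge0; rewrite mulr_ge0 ?entry_sum_ge0.
- move=> p; rewrite /exp_coef /exp_coeff /= !normrM normrX.
  rewrite (@ger0_norm _ (p`!%:R)^-1) ?invr_ge0 //.
  rewrite [leLHS](_ : _ = `|(c *m A ^+ p *m b) ord0 ord0| * `|x| ^+ p * p`!%:R^-1); last by ring.
  rewrite [leRHS](_ : _ = (entry_sum c * entry_sum A ^+ p * entry_sum b * `|x| ^+ p) * p`!%:R^-1).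
    apply: ler_wpM2r; rewrite ?invr_ge0 //.
    apply: ler_wpM2r; rewrite ?exprn_ge0 // (le_trans (le_entry_sum _ _ _)) //.
    rewrite (le_trans (entry_sumM _ _)) // ler_wpM2r ?entry_sum_ge0 //.
    elim: p => [|p IHp]; first by rewrite !expr0 mulmx1 mulr1.
    rewrite exprSr -[_ * A]/(_ *m A) mulmxA (le_trans (entry_sumM _ _)) //.
    by rewrite exprSr mulrA ler_wpM2r ?entry_sum_ge0.
  by rewrite /m exprMn; ring.
- exact: (@is_cvg_seriesZ _ _ (entry_sum c * entry_sum b) (is_cvg_series_exp_coeff m)).
Qed.

Definition exp_scalar (R : realType) (n : nat) (c : 'rV[R]_n) (A : 'M[R]_n) (b : 'cV[R]_n)
    (x : R) : R :=
  limn (pseries (exp_coef c A b) x).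

Lemma is_derive_exp_scalar (R : realType) (n : nat) (c : 'rV[R]_n) (A : 'M[R]_n)
    (b : 'cV[R]_n) (x : R) :
  is_derive x 1 (exp_scalar c A b) (exp_scalar (c *m A) A b x).
Proof.
rewrite /exp_scalar -exp_coef_diffs.
apply: (@pseries_snd_diffs _ _ (`|x| + 1)); rewrite ?exp_coef_diffs; try exact: is_cvg_exp_coef.
by rewrite [ltRHS]ger0_norm ?addr_ge0 // ltrDl.
Qed.

Lemma exprZmx (R : realType) (n : nat) (t : R) (A : 'M[R]_n) p :
  (t *: A) ^+ p = t ^+ p *: A ^+ p.
Proof.
elim: p => [|p IHp]; first by rewrite !expr0 scale1r.
by rewrite !exprS IHp -[LHS]/((t *: A) *m _) -scalemxAl -scalemxAr scalerA.
Qed.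

Lemma delta_bilin (R : realType) (m n : nat) (M : 'M[R]_(m, n)) i j :
  ((delta_mx ord0 i : 'rV_m) *m M *m (delta_mx j ord0 : 'cV_n)) ord0 ord0 = M i j.
Proof. by rewrite -rowE -colE !mxE. Qed.

Lemma expmx_entry (R : realType) (n : nat) (t : R) (A : 'M[R]_n) i j :
  expmx (t *: A) i j = exp_scalar (delta_mx ord0 i) A (delta_mx j ord0) t.
Proof.
rewrite mxE; congr (limn (series _)); apply/funext => p.
by rewrite /exp_coef /= delta_bilin exprZmx mxE mulrCA mulrC.
Qed.

Lemma expmx_bilin (R : realType) (n : nat) (c : 'rV[R]_n) (t : R) (A : 'M[R]_n)
    (b : 'cV[R]_n) :
  (c *m expmx (t *: A) *m b) ord0 ord0 = exp_scalar c A b t.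
Proof.
pose e i j := exp_coef (delta_mx ord0 i) A (delta_mx j ord0).
have eE i j p : e i j p = (p`!%:R)^-1 * (A ^+ p) i j.
  by rewrite /e /exp_coef delta_bilin.
apply/esym/cvg_lim => //.
rewrite (_ : pseries _ t = fun p =>
    \sum_j (\sum_i c ord0 i * pseries (e i j) t p) * b j ord0); last first.
  apply/funext => p; rewrite /pseries /series /=.
  under [in RHS]eq_bigr => j _ do rewrite mulr_suml.
  rewrite exchange_big /=.
  under [in RHS]eq_bigr => i _ do
    (under eq_bigr => j _ do rewrite mulr_sumr mulr_suml; rewrite exchange_big /=).
  rewrite [RHS]exchange_big /=; apply: eq_bigr => d _; rewrite /exp_coef.
  rewrite mxE mulr_sumr mulr_suml [RHS]exchange_big /=; apply: eq_bigr => j _.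
  rewrite mxE mulr_suml mulr_sumr mulr_suml; apply: eq_bigr => i _; rewrite eE; ring.
rewrite mxE; apply: cvg_big => [|j _]; first exact: add_continuous.
rewrite mxE; apply: cvgMr_tmp; apply: cvg_big => [|i _]; first exact: add_continuous.
apply: cvgMl_tmp.
rewrite expmx_entry; exact: is_cvg_exp_coef.
Qed.

Lemma expmx_commute (R : realType) (n : nat) (t : R) (A : 'M[R]_n) :
  expmx (t *: A) *m A = A *m expmx (t *: A).
Proof.
apply/matrixP => i j.
have -> : (expmx (t *: A) *m A) i j =
    ((delta_mx ord0 i : 'rV_n) *m expmx (t *: A) *m (A *m (delta_mx j ord0 : 'cV_n))) ord0 ord0.
  by rewrite [in RHS]mulmxA -[_ *m _ *m A]mulmxA delta_bilin.
have -> : (A *m expmx (t *: A)) i j =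
    ((delta_mx ord0 i : 'rV_n) *m A *m expmx (t *: A) *m (delta_mx j ord0 : 'cV_n)) ord0 ord0.
  by rewrite -[_ *m A *m _]mulmxA delta_bilin.
rewrite !expmx_bilin /exp_scalar; congr (limn (pseries _ _)); apply/funext => p.
rewrite /exp_coef !mulmxA; congr (_ * (_ *m _) _ _).
by rewrite -!mulmxA; congr (_ *m _); rewrite -[LHS]/(A ^+ p * A) -exprSr exprS.
Qed.

Lemma expmx0 (R : realType) (n : nat) (A : 'M[R]_n) : expmx (0 *: A) = 1%:M.
Proof.
apply/matrixP => i j; rewrite expmx_entry; apply: lim_near_cst => //.
near=> p; rewrite -[p]prednK; last by near: p; exact: nbhs_infty_gt.
rewrite /pseries /series /= big_nat_recl // big1 => [|d _]; last first.
  by rewrite exprS mul0r mulr0.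
by rewrite addr0 expr0 mulr1 /exp_coef delta_bilin fact0 invr1 mul1r.
Unshelve. all: by end_near.
Qed.

Lemma is_derive_expmx (R : realType) (n : nat) (A : 'M[R]_n) i j (t : R) :
  is_derive t 1 (fun x => expmx (x *: A) i j) ((A *m expmx (t *: A)) i j).
Proof.
rewrite (_ : (fun x => _) = exp_scalar (delta_mx ord0 i) A (delta_mx j ord0)); last first.
  by apply/funext => x; rewrite expmx_entry.
have -> : (A *m expmx (t *: A)) i j = exp_scalar (delta_mx ord0 i *m A) A (delta_mx j ord0) t.
  by rewrite -expmx_bilin -[_ *m A *m _]mulmxA delta_bilin.
exact: is_derive_exp_scalar.
Qed.

(** * Differential calculus on the half-line *)

(** Signals live on the closed half-line: differentiable for t > 0, continuous from
    the right at 0. *)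
Definition hderiv (R : realType) (f f' : R -> R) : Prop :=
  f x @[x --> 0^'+] --> f 0 /\ forall t : R, 0 < t -> is_derive t 1 f (f' t).

Lemma hderiv_of_deriv (R : realType) (f f' : R -> R) :
  (forall t : R, is_derive t 1 f (f' t)) -> hderiv f f'.
Proof.
move=> df; split=> // .
apply: cvg_at_right_filter; apply: differentiable_continuous.
by apply/derivable1_diffP; have [] := df 0.
Qed.

Lemma hderiv_cst (R : realType) (c : R) : hderiv (fun=> c) (fun=> 0).
Proof. by apply: hderiv_of_deriv => t; exact: is_derive_cst. Qed.

Lemma hderivD (R : realType) (f g f' g' : R -> R) :
  hderiv f f' -> hderiv g g' -> hderiv (fun t => f t + g t) (fun t => f' t + g' t).
Proof.
move=> [cf df] [cg dg]; split; first exact: cvgD.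
by move=> t t0; exact: (is_deriveD (df t t0) (dg t t0)).
Qed.

Lemma hderivM (R : realType) (f g f' g' : R -> R) :
  hderiv f f' -> hderiv g g' ->
  hderiv (fun t => f t * g t) (fun t => f' t * g t + f t * g' t).
Proof.
move=> [cf df] [cg dg]; split; first exact: cvgM.
move=> t t0; have dfg := is_deriveM (df t t0) (dg t t0).
apply: is_derive_eq dfg _.
by rewrite addrC /GRing.scale /= [g t * _]mulrC.
Qed.

Lemma hderiv_sum (R : realType) (I : Type) (r : seq I) (f f' : I -> R -> R) :
  (forall i, hderiv (f i) (f' i)) ->
  hderiv (fun t => \sum_(i <- r) f i t) (fun t => \sum_(i <- r) f' i t).
Proof.
move=> df; elim: r => [|i r IHr].
  by under eq_fun do rewrite big_nil; under [X in hderiv _ X]eq_fun do rewrite big_nil; exact: hderiv_cst.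
under eq_fun do rewrite big_cons; under [X in hderiv _ X]eq_fun do rewrite big_cons.
exact: hderivD.
Qed.

Lemma hderiv_ext (R : realType) (f g f' g' : R -> R) :
  (forall t, 0 <= t -> f t = g t) -> (forall t, 0 < t -> f' t = g' t) ->
  hderiv f f' -> hderiv g g'.
Proof.
move=> fg fg' [cf df]; split.
  rewrite -fg //; apply: cvg_trans cf; apply: near_eq_cvg.
  by near=> x; apply: fg; apply: ltW; near: x; exact: nbhs_right_gt.
move=> t t0; rewrite -fg' //; have := df t t0; apply: near_eq_is_derive => //.
by near=> x; rewrite fg //; apply: ltW; near: x; exact: lt_nbhsr.
Unshelve. all: by end_near.
Qed.

Lemma hderiv_le (R : realType) (f f' : R -> R) (s t : R) : hderiv f f' ->
  0 <= s -> s <= t -> (forall u, s < u -> f' u <= 0) -> f t <= f s.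
Proof.
move=> [cf df] s0; rewrite le_eqVlt => /predU1P[->//|st] f'_le0.
have cont x : 0 < x -> {for x, continuous f}.
  move=> x0; apply: differentiable_continuous; apply/derivable1_diffP.
  by have [] := df x x0.
have inside x : x \in `]s, t[ -> s < x /\ 0 < x.
  by rewrite in_itv /= => /andP[sx _]; split=> //; exact: le_lt_trans sx.
apply: (@ler0_derive1_le_cc R f s t) => //.
- by move=> x /inside[_ x0]; have [] := df x x0.
- by move=> x /inside[sx x0]; have [] := df x x0; rewrite derive1E => _ ->; exact: f'_le0.
- apply/continuous_within_itvP => //; split.
  + by move=> x /inside[_ x0]; exact: cont.
  + move: s0; rewrite le_eqVlt => /predU1P[<- //|s0].
    exact: cvg_at_right_filter (cont _ s0).
  + exact: cvg_at_left_filter (cont _ (le_lt_trans s0 st)).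
- by rewrite in_itv /= lexx ltW.
- by rewrite in_itv /= lexx ltW.
- exact: ltW.
Qed.

Lemma hderiv0_cst (R : realType) (f f' : R -> R) : hderiv f f' ->
  (forall t, 0 < t -> f' t = 0) -> forall t, 0 <= t -> f t = f 0.
Proof.
move=> df f'0 t t0; apply/eqP; rewrite eq_le.
apply/andP; split; first by apply: (hderiv_le df) => // u u0; rewrite f'0.
have := hderivM (hderiv_cst (-1)) df.
move=> /hderiv_le/(_ (lexx 0) t0); rewrite !mulN1r lerN2; apply=> u u0.
by rewrite f'0 // mul0r mulr0 addr0.
Qed.

Definition mderiv (R : realType) (m n : nat) (F F' : R -> 'M[R]_(m, n)) : Prop :=
  forall i j, hderiv (fun t => F t i j) (fun t => F' t i j).

Section MatrixDerivative.
Variable R : realType.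

Lemma mderiv_ext (m n : nat) (F G F' G' : R -> 'M[R]_(m, n)) :
  (forall t, 0 <= t -> F t = G t) -> (forall t, 0 < t -> F' t = G' t) ->
  mderiv F F' -> mderiv G G'.
Proof.
by move=> FG FG' dF i j; apply: hderiv_ext (dF i j) => t t0; rewrite (FG, FG').
Qed.

Lemma mderiv_cst (m n : nat) (A : 'M[R]_(m, n)) : mderiv (fun=> A) (fun=> 0).
Proof.
move=> i j; apply: hderiv_ext (hderiv_cst (A i j)) => // t _; by rewrite mxE.
Qed.

Lemma mderivD (m n : nat) (F G F' G' : R -> 'M[R]_(m, n)) :
  mderiv F F' -> mderiv G G' -> mderiv (fun t => F t + G t) (fun t => F' t + G' t).
Proof.
by move=> dF dG i j; apply: hderiv_ext (hderivD (dF i j) (dG i j)) => t _; rewrite mxE.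
Qed.

Lemma mderivM (m n p : nat) (F F' : R -> 'M[R]_(m, n)) (G G' : R -> 'M[R]_(n, p)) :
  mderiv F F' -> mderiv G G' ->
  mderiv (fun t => F t *m G t) (fun t => F' t *m G t + F t *m G' t).
Proof.
move=> dF dG i j.
apply: hderiv_ext (hderiv_sum _ (fun k => hderivM (dF i k) (dG k j))) => t _.
  by rewrite mxE.
by rewrite !mxE -big_split.
Qed.

Lemma mderiv_mull (m n p : nat) (A : 'M[R]_(m, n)) (G G' : R -> 'M[R]_(n, p)) :
  mderiv G G' -> mderiv (fun t => A *m G t) (fun t => A *m G' t).
Proof.
move=> dG; apply: mderiv_ext (mderivM (mderiv_cst A) dG) => // t _.
by rewrite mul0mx add0r.
Qed.

Lemma mderiv_mulr (m n p : nat) (A : 'M[R]_(n, p)) (G G' : R -> 'M[R]_(m, n)) :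
  mderiv G G' -> mderiv (fun t => G t *m A) (fun t => G' t *m A).
Proof.
move=> dG; apply: mderiv_ext (mderivM dG (mderiv_cst A)) => // t _.
by rewrite mulmx0 addr0.
Qed.

Lemma mderivB (m n : nat) (F G F' G' : R -> 'M[R]_(m, n)) :
  mderiv F F' -> mderiv G G' -> mderiv (fun t => F t - G t) (fun t => F' t - G' t).
Proof.
move=> dF dG; have := mderivD dF (mderiv_mull (-1)%:M dG).
by apply: mderiv_ext => t _; rewrite mul_scalar_mx scaleN1r.
Qed.

Lemma mderiv_tr (m n : nat) (F F' : R -> 'M[R]_(m, n)) :
  mderiv F F' -> mderiv (fun t => (F t)^T) (fun t => (F' t)^T).
Proof. by move=> dF i j; apply: hderiv_ext (dF j i) => t _; rewrite mxE. Qed.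

Lemma mderiv_col_mx (m1 m2 n : nat) (F F' : R -> 'M[R]_(m1, n)) (G G' : R -> 'M[R]_(m2, n)) :
  mderiv F F' -> mderiv G G' ->
  mderiv (fun t => col_mx (F t) (G t)) (fun t => col_mx (F' t) (G' t)).
Proof.
move=> dF dG i j; case: (split_ordP i) => k ->.
  by apply: hderiv_ext (dF k j) => t _; rewrite col_mxEu.
by apply: hderiv_ext (dG k j) => t _; rewrite col_mxEd.
Qed.

Lemma hderiv_trace (n : nat) (F F' : R -> 'M[R]_n) :
  mderiv F F' -> hderiv (fun t => \tr (F t)) (fun t => \tr (F' t)).
Proof. by move=> dF; exact: hderiv_sum. Qed.

Lemma mderiv0_cst (m n : nat) (F F' : R -> 'M[R]_(m, n)) : mderiv F F' ->
  (forall t, 0 < t -> F' t = 0) -> forall t, 0 <= t -> F t = F 0.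
Proof.
move=> dF F'0 t t0; apply/matrixP => i j; apply: (hderiv0_cst (dF i j)) => // u u0.
by rewrite F'0 // mxE.
Qed.

Lemma mderiv_expmx (n : nat) (A : 'M[R]_n) :
  mderiv (fun t => expmx (t *: A)) (fun t => A *m expmx (t *: A)).
Proof. by move=> i j; apply: hderiv_of_deriv => t; exact: is_derive_expmx. Qed.

(** The left-hand side has derivative 0 in s. *)
Lemma expmx_sub (n : nat) (A : 'M[R]_n) (u s : R) : 0 <= s ->
  expmx ((u + s) *: A) *m expmx (s *: - A) = expmx (u *: A).
Proof.
move=> s0; have dE : mderiv (fun t => expmx ((u + t) *: A)) (fun t => A *m expmx ((u + t) *: A)).
  move=> i j; apply: hderiv_of_deriv => t.
  have := @is_derive1_comp R (fun x => expmx (x *: A) i j) (fun x => u + x) t _ _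
    (is_derive_expmx A i j (u + t)) (is_deriveD (is_derive_cst u t 1) (is_derive_id t 1)).
  by rewrite add0r mulr1.
have := mderivM dE (mderiv_expmx (- A)).
move=> /mderiv0_cst/(_ _ s s0) ->; last first.
  by move=> t _; rewrite mulNmx mulmxN [X in _ - X]mulmxA expmx_commute subrr.
by rewrite expmx0 addr0 mulmx1.
Qed.

Lemma expmx_inv (n : nat) (A : 'M[R]_n) (s : R) : 0 <= s ->
  expmx (s *: A) *m expmx (s *: - A) = 1%:M.
Proof. by move=> s0; have := expmx_sub A 0 s0; rewrite add0r expmx0. Qed.

(** The product F(t) e^(-tA) is constant. *)
Lemma mderiv_linear0 (m n : nat) (A : 'M[R]_n) (F : R -> 'M[R]_(m, n)) :
  mderiv F (fun t => F t *m A) -> F 0 = 0 -> forall t, 0 <= t -> F t = 0.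
Proof.
move=> dF F0 t t0.
have := mderivM dF (mderiv_expmx (- A)) => /mderiv0_cst/(_ _ t t0).
rewrite F0 mul0mx => H.
have {}H : F t *m expmx (t *: - A) = 0.
  by apply: H => u _; rewrite mulNmx mulmxN mulmxA subrr.
have := congr1 (mulmx^~ (expmx (t *: A))) H.
by rewrite mul0mx -mulmxA -{2}[A]opprK expmx_inv // mulmx1.
Qed.

End MatrixDerivative.

(** * Decay of the exponential of a Hurwitz matrix *)

Lemma damped_cvg0 (R : realType) (rho rho' v : R -> R) (c : R) : 0 < c ->
  hderiv rho rho' -> (forall t, 0 <= t -> 0 <= rho t) ->
  (forall t, 0 < t -> rho' t <= - c * rho t + v t) ->
  v t @[t --> +oo] --> 0 -> rho t @[t --> +oo] --> 0.
Proof.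
move=> c0 drho rho_ge0 le_rho' v0; apply/cvgrPdist_le => e e0 /=.
pose h := e / 2; have h0 : 0 < h by rewrite divr_gt0.
have ch0 : 0 < c * h by rewrite mulr_gt0.
have [T [_ vT]] : \forall t \near +oo, `|v t| <= c * h.
  by move/cvgr0Pnorm_le: v0; exact.
pose T1 := Num.max 0 T.
have T1_ge0 : 0 <= T1 by rewrite le_max lexx.
(* e^(c t) (rho - h) is nonincreasing as soon as v <= c h. *)
have bound t : T1 <= t -> expR (c * t) * (rho t - h) <= expR (c * T1) * (rho T1 - h).
  move=> T1t; have dexp : hderiv (fun t => expR (c * t)) (fun t => c * expR (c * t)).
    apply: hderiv_of_deriv => u.
    have := @is_derive1_comp R expR (fun x => c * x) u _ _
      (is_derive_expR (c * u)) (is_deriveZ c (is_derive_id u 1)).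
    by move=> H; apply: is_derive_eq H _; rewrite /GRing.scale /= mulr1 mulrC.
  have := hderivM dexp (hderivD drho (hderiv_cst (- h))).
  move=> /hderiv_le; apply=> // u T1u.
  have u0 : 0 < u by exact: le_lt_trans T1u.
  have Tu : T < u by apply: le_lt_trans T1u; rewrite le_max lexx orbT.
  have vu : v u <= c * h := le_trans (ler_norm _) (vT u Tu).
  rewrite addr0 -mulrA mulrCA -mulrDr pmulr_rle0 ?expR_gt0 //.
  by have := le_rho' u u0; nra.
have small : \forall t \near +oo, expR (- (c * t)) * (expR (c * T1) * rho T1) <= h.
  have K0 : 0 <= expR (c * T1) * rho T1 by rewrite mulr_ge0 ?expR_ge0 ?rho_ge0.
  near=> t; have t_gt : (expR (c * T1) * rho T1) / (c * h) < t by near: t; exact: nbhs_pinfty_gt (num_real _).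
  rewrite expRN ler_pdivrMl ?expR_gt0 //.
  have : 1 + c * t <= expR (c * t) by exact: expR_ge1Dx.
  move: t_gt; rewrite ltr_pdivrMr // => t_gt E.
  by have := h0; nra.
near=> t; rewrite sub0r normrN.
have t_T1 : T1 < t by near: t; exact: nbhs_pinfty_gt (num_real _).
have rt : 0 <= rho t by apply: rho_ge0; exact: le_trans (ltW t_T1).
rewrite ger0_norm //.
have := bound t (ltW t_T1); rewrite -ler_pdivlMl ?expR_gt0 // -expRN => B.
have S : expR (- (c * t)) * (expR (c * T1) * rho T1) <= h by near: t.
have P1 : 0 <= expR (- (c * t)) * (expR (c * T1) * h).
  by rewrite !mulr_ge0 ?expR_ge0 // ltW.
have hE : e = h + h by rewrite /h; field.
by move: B; rewrite !mulrBr; lra.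
Unshelve. all: by end_near.
Qed.

Lemma ReD (R : realType) (x y : R[i]) : complex.Re (x + y) = complex.Re x + complex.Re y.
Proof. by case: x y => [? ?] [? ?]. Qed.

Lemma ImD (R : realType) (x y : R[i]) : complex.Im (x + y) = complex.Im x + complex.Im y.
Proof. by case: x y => [? ?] [? ?]. Qed.

Lemma Re_cmx_mul (R : realType) (m n p : nat) (A : 'M[R]_(m, n)) (P : 'M[R[i]]_(n, p)) :
  map_mx (@complex.Re R) (cmx A *m P) = A *m map_mx (@complex.Re R) P.
Proof.
apply/matrixP => i j; rewrite !mxE (big_morph _ (@ReD R) (erefl : complex.Re 0 = 0)).
by apply: eq_bigr => k _; rewrite !mxE; case: (P k j) => x y; rewrite /real_complex_def; simpc.
Qed.

Lemma Im_cmx_mul (R : realType) (m n p : nat) (A : 'M[R]_(m, n)) (P : 'M[R[i]]_(n, p)) :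
  map_mx (@complex.Im R) (cmx A *m P) = A *m map_mx (@complex.Im R) P.
Proof.
apply/matrixP => i j; rewrite !mxE (big_morph _ (@ImD R) (erefl : complex.Im 0 = 0)).
by apply: eq_bigr => k _; rewrite !mxE; case: (P k j) => x y; rewrite /real_complex_def; simpc.
Qed.

(** e^(tA) P tends to 0, for a complex P, stated on real and imaginary parts. *)
Definition decays (R : realType) (n : nat) (A : 'M[R]_n) (P : 'M[R[i]]_n) : Prop :=
  forall i j,
    (expmx (t *: A) *m map_mx (@complex.Re R) P) i j @[t --> +oo] --> (0 : R) /\
    (expmx (t *: A) *m map_mx (@complex.Im R) P) i j @[t --> +oo] --> (0 : R).

(** Along the columns of e^(tA) P one has y' = z y + u, where u comes from
    (A - z) P; the squared modulus of y is damped at the rate - Re z. *)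
Lemma decays_factor (R : realType) (n : nat) (A : 'M[R]_n) (P : 'M[R[i]]_n) (z : R[i]) :
  complex.Re z < 0 -> decays A ((cmx A - z%:M) *m P) -> decays A P.
Proof.
case: z => a b /= a0 dec i j.
pose y1 t := (expmx (t *: A) *m map_mx (@complex.Re R) P) i j.
pose y2 t := (expmx (t *: A) *m map_mx (@complex.Im R) P) i j.
pose u1 t := (expmx (t *: A) *m map_mx (@complex.Re R) ((cmx A - (Complex a b)%:M) *m P)) i j.
pose u2 t := (expmx (t *: A) *m map_mx (@complex.Im R) ((cmx A - (Complex a b)%:M) *m P)) i j.
have [u1_0 u2_0] := dec i j.
have dexp (Q : 'M[R]_n) : mderiv (fun t => expmx (t *: A) *m Q)
    (fun t => expmx (t *: A) *m (A *m Q)).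
  apply: mderiv_ext (mderiv_mulr Q (mderiv_expmx A)) => // t _.
  by rewrite -expmx_commute mulmxA.
have reE : map_mx (@complex.Re R) ((cmx A - (Complex a b)%:M) *m P) =
    A *m map_mx (@complex.Re R) P - a *: map_mx (@complex.Re R) P + b *: map_mx (@complex.Im R) P.
  rewrite mulmxBl mul_scalar_mx -Re_cmx_mul; apply/matrixP => k l; rewrite !mxE.
  by case: (P k l) => x y; rewrite ReD; simpc; rewrite /=; ring.
have imE : map_mx (@complex.Im R) ((cmx A - (Complex a b)%:M) *m P) =
    A *m map_mx (@complex.Im R) P - a *: map_mx (@complex.Im R) P - b *: map_mx (@complex.Re R) P.
  rewrite mulmxBl mul_scalar_mx -Im_cmx_mul; apply/matrixP => k l; rewrite !mxE.
  by case: (P k l) => x y; rewrite ImD; simpc; rewrite /=; ring.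
have dy1 : hderiv y1 (fun t => a * y1 t - b * y2 t + u1 t).
  apply: hderiv_ext (dexp _ i j) => // t _.
  rewrite /u1 reE mulmxDr mulmxBr -!scalemxAr; rewrite [in RHS]mxE [in RHS]mxE.
  by rewrite [in X in _ + (_ + X + _)]mxE [in X in _ + (_ + X + _)]mxE [in X in _ + (_ + X)]mxE /y1 /y2; ring.
have dy2 : hderiv y2 (fun t => b * y1 t + a * y2 t + u2 t).
  apply: hderiv_ext (dexp _ i j) => // t _.
  rewrite /u2 imE !mulmxBr -!scalemxAr; rewrite [in RHS]mxE [in RHS]mxE.
  by rewrite [in X in _ + (_ + X + _)]mxE [in X in _ + (_ + X + _)]mxE [in X in _ + (_ + X)]mxE [in X in _ + (_ + X)]mxE /y1 /y2; ring.
pose rho t := y1 t * y1 t + y2 t * y2 t.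
have drho := hderivD (hderivM dy1 dy1) (hderivM dy2 dy2).
have rho0 : rho t @[t --> +oo] --> (0 : R).
  apply: (@damped_cvg0 R rho _ (fun t => (u1 t * u1 t + u2 t * u2 t) / (- a)) (- a)
    _ drho) => //.
  - by rewrite oppr_gt0.
  - by move=> t _; rewrite /rho -!expr2 addr_ge0 ?sqr_ge0.
  - move=> t _; have na : 0 < - a by rewrite oppr_gt0.
    rewrite /rho -subr_ge0.
    have -> : - - a * (y1 t * y1 t + y2 t * y2 t) + (u1 t * u1 t + u2 t * u2 t) / - a -
       ((a * y1 t - b * y2 t + u1 t) * y1 t + y1 t * (a * y1 t - b * y2 t + u1 t) +
        ((b * y1 t + a * y2 t + u2 t) * y2 t + y2 t * (b * y1 t + a * y2 t + u2 t))) =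
       ((a * y1 t + u1 t) ^+ 2 + (a * y2 t + u2 t) ^+ 2) / - a.
      by field; rewrite lt_eqF.
    by rewrite mulr_ge0 ?addr_ge0 ?sqr_ge0 // invr_ge0 ltW.
  - rewrite -[X in _ --> X](mul0r (- a)^-1); apply: cvgMr_tmp.
    rewrite -[X in _ --> X](addr0 (0 : R)); apply: cvgD.
      by rewrite -[X in _ --> X](mul0r (0 : R)); exact: cvgM.
    by rewrite -[X in _ --> X](mul0r (0 : R)); exact: cvgM.
have half (y : R -> R) : (forall t, y t * y t <= rho t) -> y t @[t --> +oo] --> (0 : R).
  move=> y_le; apply/cvgr0Pnorm_le => e e0.
  have ee0 : 0 < e ^+ 2 by rewrite exprn_gt0.
  move/cvgr0Pnorm_le: rho0 => /(_ _ ee0); apply: filterS => t.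
  move=> /(le_trans (ler_norm _)) rt.
  rewrite -ler_sqr ?nnegrE ?normr_ge0 ?(ltW e0) // real_normK ?num_real //.
  by rewrite [leLHS]expr2 (le_trans (y_le t)).
by split; apply: half => t; rewrite /rho -!expr2 (lerDl, lerDr) sqr_ge0.
Qed.

(** Cayley-Hamilton: the product of the factors A - z over the eigenvalues is 0, and
    decays_factor removes them one at a time. *)
Lemma expmx_cvg0 (R : realType) (n : nat) (A : 'M[R]_n) :
  (forall z, root (map_poly (real_complex R) (char_poly A)) z -> complex.Re z < 0) ->
  forall i j, expmx (t *: A) i j @[t --> +oo] --> (0 : R).
Proof.
case: n A => [|n] A stable; first by case.
have [rs rsE] := closed_field_poly_normal (map_poly (real_complex R) (char_poly A)).
have [rs_stable CH] : (forall z, z \in rs -> complex.Re z < 0) /\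
    horner_mx (cmx A) (\prod_(z <- rs) ('X - z%:P)) = 0.
  have /monicP lead1 : map_poly (real_complex R) (char_poly A) \is monic.
    by rewrite map_monic char_poly_monic.
  move: rsE; rewrite lead1 scale1r => rsE; split.
    by move=> z zrs; apply: stable; rewrite rsE root_prod_XsubC.
  by rewrite -rsE map_char_poly; exact: Cayley_Hamilton.
have chain P : decays A (horner_mx (cmx A) (\prod_(z <- rs) ('X - z%:P)) *m P) -> decays A P.
  elim: rs rs_stable {rsE CH} P => [|z rs IHrs] st P.
    by rewrite big_nil rmorph1 mul1mx.
  rewrite big_cons rmorphM rmorphB /= horner_mx_X horner_mx_C -[_ * _]/(_ *m _) -mulmxA.
  move/(decays_factor (st z (mem_head _ _))); apply: IHrs => y yrs.
  by apply: st; rewrite inE yrs orbT.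
have dec1 : decays A 1%:M.
  apply: chain; rewrite CH mul0mx => i j.
  have re0 : map_mx (@complex.Re R) (0 : 'M[R[i]]_n.+1) = 0 by apply/matrixP => ? ?; rewrite !mxE.
  have im0 : map_mx (@complex.Im R) (0 : 'M[R[i]]_n.+1) = 0 by apply/matrixP => ? ?; rewrite !mxE.
  by split; rewrite (re0, im0); under eq_fun do rewrite mulmx0 mxE; exact: cvg_cst.
move=> i j; have [+ _] := dec1 i j.
have -> : map_mx (@complex.Re R) (1%:M : 'M[R[i]]_n.+1) = 1%:M.
  by apply/matrixP => k l; rewrite !mxE; case: eqP.
by under eq_fun do rewrite mulmx1.
Qed.

(** * Nonnegativity of the storage function *)

Definition bform (R : realType) (n : nat) (S : 'M[R]_n) (u v : 'cV[R]_n) : R :=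
  (u^T *m S *m v) ord0 ord0.

Lemma bformC (R : realType) (n : nat) (S : 'M[R]_n) (u v : 'cV[R]_n) :
  S^T = S -> bform S u v = bform S v u.
Proof.
move=> Ssym; rewrite /bform.
have <- : (v^T *m S *m u)^T = u^T *m S *m v by rewrite !trmx_mul trmxK Ssym mulmxA.
by rewrite mxE.
Qed.

Lemma bform_ge0 (R : realType) (n : nat) (S : 'M[R]_n) (u : 'cV[R]_n) :
  posdef S -> 0 <= bform S u u.
Proof.
move=> [_ S_gt0]; have [->|u0] := eqVneq u 0; last exact: ltW (S_gt0 u u0).
by rewrite /bform mulmx0 mxE.
Qed.

(** Each row of Z is the state of one copy of delta, and S couples the copies: this
    is the sum over i, j of S_ij times the form beta polarised at rows i and j. *)
Definition storage (R : realType) (m N : nat) (S : 'M[R]_m) (beta : 'M[R]_N)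
    (Z : 'M[R]_(m, N)) : R :=
  \tr (S *m Z *m beta *m Z^T).

(** The storage identity, with products of scalar signals replaced by the form S of
    the vector signals obtained from the m rows. *)
Lemma hderiv_storage (R : realType) (m N : nat) (S : 'M[R]_m) (beta : 'M[R]_N)
    (q s r : R) (a b c : {poly R}) (Z : R -> 'M[R]_(m, N)) (G : R -> 'M[R]_(m, N.+1)) :
  S^T = S ->
  lure_identity q s r a b c beta ->
  (forall t, 0 <= t -> Z t = G t *m (init_rows N)^T) ->
  mderiv Z (fun t => G t *m (tail_rows N)^T) ->
  hderiv (fun t => storage S beta (Z t))
    (fun t => let u := G t *m coef_col N a in let v := G t *m coef_col N b in
       let w := G t *m coef_col N c in
       q * bform S u u + 2 * s * bform S u v + r * bform S v v - bform S w w).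
Proof.
move=> Ssym kyp ZG dZ.
have trb (H : 'M[R]_(m, N.+1)) (u v : 'cV[R]_N.+1) :
    \tr (S *m (H *m (u *m v^T) *m H^T)) = bform S (H *m u) (H *m v).
  have -> : S *m (H *m (u *m v^T) *m H^T) = (S *m (H *m u)) *m (H *m v)^T.
    by rewrite trmx_mul !mulmxA.
  by rewrite bformC // mxtrace_mulC /mxtrace big_ord1 /bform !mulmxA.
apply: hderiv_ext (hderiv_trace (mderivM (mderivM (mderiv_mull S dZ) (mderiv_cst beta))
  (mderiv_tr dZ))) => // t t0.
rewrite mulmx0 addr0 !ZG ?ltW // !trmx_mul !trmxK.
transitivity (\tr (S *m (G t *m ((tail_rows N)^T *m beta *m init_rows N
    + (init_rows N)^T *m beta *m tail_rows N) *m (G t)^T))).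
  by congr (\tr _); rewrite mulmxDr mulmxDl mulmxDr !mulmxA.
pose T (K : 'M[R]_N.+1) := \tr (S *m (G t *m K *m (G t)^T)).
have TD K1 K2 : T (K1 + K2) = T K1 + T K2.
  by rewrite /T mulmxDr mulmxDl mulmxDr mxtraceD.
have TZ x K : T (x *: K) = x * T K.
  by rewrite /T -scalemxAr -scalemxAl -scalemxAr mxtraceZ.
rewrite -/(T _) kyp /= -scaleN1r !(TD, TZ) /T !trb.
by rewrite [bform S (_ *m coef_col N b) (_ *m coef_col N a)]bformC //; ring.
Qed.

Lemma cvg_mulmx (R : realType) (m n p : nat) (F : R -> 'M[R]_(m, n))
    (G : R -> 'M[R]_(n, p)) (A : 'M[R]_(m, n)) (B : 'M[R]_(n, p)) :
  (forall i j, F t i j @[t --> +oo] --> A i j) ->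
  (forall i j, G t i j @[t --> +oo] --> B i j) ->
  forall i j, (F t *m G t) i j @[t --> +oo] --> (A *m B) i j.
Proof.
move=> FA GB i j; under eq_fun do rewrite mxE; rewrite mxE.
apply: cvg_big => [|k _]; [exact: add_continuous|exact: cvgM].
Qed.

(** Starting from Z, let the m copies of delta run with zero input: the storage
    decreases since r <= 0, and it tends to 0 since a is Hurwitz. *)
Lemma storage_ge0 (R : realType) (m N : nat) (S : 'M[R]_m) (beta : 'M[R]_N)
    (q s r : R) (a b c : {poly R}) (Z : 'M[R]_(m, N)) :
  r <= 0 -> posdef S -> a \is monic -> size a = N.+1 ->
  (forall z, root (map_poly (real_complex R) a) z -> complex.Re z < 0) ->
  lure_identity q s r a b c beta ->
  0 <= storage S beta Z.
Proof.
move=> r_le0 Spos a_monic sa stable kyp.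
pose E t := expmx (t *: comp_A N a).
pose Zt t := Z *m (E t)^T.
pose G t := Zt t *m (ext_rows N a)^T.
have dZ : mderiv Zt (fun t => G t *m (tail_rows N)^T).
  have := mderiv_mull Z (mderiv_tr (mderiv_expmx (comp_A N a))).
  apply: mderiv_ext => // t _.
  by rewrite /G /Zt /E -[X in _ = X]mulmxA -trmx_mul -mulmxA -trmx_mul.
have ZG (t : R) : 0 <= t -> Zt t = G t *m (init_rows N)^T.
  by move=> _; rewrite /G -mulmxA -trmx_mul init_ext trmx1 mulmx1.
have Ga t : G t *m coef_col N a = 0.
  rewrite /G -mulmxA -[coef_col N a]trmxK -trmx_mul coef_ext // trmx0 mulmx0.
  by [].
have dV := hderiv_storage Spos.1 kyp ZG dZ.
have decr (t : R) : 0 <= t -> storage S beta (Zt t) <= storage S beta (Zt 0).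
  move=> t0; apply: (hderiv_le dV) => // u _ /=; rewrite Ga.
  have b0 (v : 'cV_m) : bform S 0 v = 0 by rewrite /bform trmx0 !mul0mx mxE.
  rewrite !b0 !mulr0 !add0r subr_le0 (le_trans _ (bform_ge0 _ Spos)) //.
  by rewrite mulr_le0_ge0 ?bform_ge0.
have E0 i j : (E t)^T i j @[t --> +oo] --> (0 : 'M[R]_N) i j.
  under eq_fun do rewrite mxE; rewrite mxE; apply: expmx_cvg0.
  by rewrite char_poly_comp.
have cst m1 n1 (A : 'M[R]_(m1, n1)) i j : (fun=> A) t i j @[t --> +oo] --> A i j.
  exact: cvg_cst.
have Z0 := cvg_mulmx (cst R _ _ Z) E0.
have ZT0 i j : (Zt t)^T i j @[t --> +oo] --> (Z *m 0)^T i j.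
  by under eq_fun do rewrite mxE; rewrite mxE; exact: Z0.
have V0 : storage S beta (Zt t) @[t --> +oo] --> (0 : R).
  have -> : 0 = \tr (S *m (Z *m 0) *m beta *m (Z *m 0)^T) :> R.
    by rewrite mulmx0 trmx0 mulmx0 mxtrace0.
  apply: cvg_big => [|i _]; first exact: add_continuous.
  exact: (cvg_mulmx (cvg_mulmx (cvg_mulmx (cst R _ _ S) Z0) (cst R _ _ beta)) ZT0).
rewrite leNgt; apply/negP => V_lt0.
have Zt0 : Zt 0 = Z by rewrite /Zt /E expmx0 trmx1 mulmx1.
move: V0 => /cvgr0Pnorm_lt/(_ (- storage S beta Z)); rewrite oppr_gt0 => /(_ V_lt0) V0.
have : \forall t \near (+oo : set_system R), False.
  near=> t; have : `|storage S beta (Zt t)| < - storage S beta Z by near: t.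
  have := decr t; rewrite Zt0 => /(_ _) le.
  have {}le : storage S beta (Zt t) <= storage S beta Z by apply: le; near: t; exact: nbhs_pinfty_ge (num_real _).
  rewrite ltr0_norm ?(le_lt_trans le) // ltrN2 => H.
  by have := lt_le_trans H le; rewrite ltxx.
by move=> /filter_ex[].
Unshelve. all: by end_near.
Qed.

(** * Bounds for quadratic forms *)

Definition sqnorm (R : realType) (n : nat) (u : 'cV[R]_n) : R := \sum_(i < n) u i ord0 ^+ 2.

Lemma sqnorm_ge0 (R : realType) (n : nat) (u : 'cV[R]_n) : 0 <= sqnorm u.
Proof. by apply: sumr_ge0 => i _; exact: sqr_ge0. Qed.

Lemma sqnorm_entry (R : realType) (n : nat) (u : 'cV[R]_n) i : u i ord0 ^+ 2 <= sqnorm u.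
Proof. by rewrite /sqnorm (bigD1 i) //= lerDl sumr_ge0 // => j _; exact: sqr_ge0. Qed.

Lemma sqnorm_col_mx (R : realType) (m n : nat) (u : 'cV[R]_m) (v : 'cV[R]_n) :
  sqnorm (col_mx u v) = sqnorm u + sqnorm v.
Proof.
rewrite /sqnorm big_split_ord /=; congr (_ + _); apply: eq_bigr => i _.
  by rewrite col_mxEu.
by rewrite col_mxEd.
Qed.

Lemma sqnorm0 (R : realType) (n : nat) : sqnorm (0 : 'cV[R]_n) = 0.
Proof. by rewrite /sqnorm big1 // => i _; rewrite mxE expr0n. Qed.

Lemma bform_le (R : realType) (n : nat) (S : 'M[R]_n) :
  exists2 C : R, 0 < C & forall u, bform S u u <= C * sqnorm u.
Proof.
exists (1 + entry_sum S); first by rewrite ltr_pwDl ?entry_sum_ge0.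
move=> u; apply: (@le_trans _ _ (entry_sum S * sqnorm u)); last first.
  by rewrite ler_wpM2r ?sqnorm_ge0 // lerDr.
rewrite /bform mxE /entry_sum exchange_big /= mulr_suml; apply: ler_sum => j _.
rewrite mxE !mulr_suml; apply: ler_sum => i _; rewrite mxE.
have := sqnorm_entry u i; have := sqnorm_entry u j.
set x := u i ord0; set y := u j ord0; set n2 := sqnorm u => yn xn.
rewrite (le_trans (ler_norm _)) // mulrAC normrM mulrC ler_wpM2l //.
rewrite ler_norml; nra.
Qed.

Lemma bform_pencil (R : realType) (n : nat) (S : 'M[R]_n) (u g : 'cV[R]_n) (t : R) :
  S^T = S ->
  bform S (u - t *: g) (u - t *: g) =
  bform S u u - 2 * t * bform S u g + t ^+ 2 * bform S g g.
Proof.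
move=> Ssym; have tE : (u - t *: g)^T = u^T - t *: g^T by rewrite linearB linearZ.
have ug : (g^T *m S *m u) ord0 ord0 = bform S u g by rewrite [RHS]bformC.
rewrite /bform tE !mulmxBl !mulmxBr -!scalemxAl -!scalemxAr.
have E (M1 M2 M3 M4 : 'M[R]_1) :
    (M1 - t *: M2 - (t *: M3 - t *: (t *: M4))) ord0 ord0 =
    M1 ord0 ord0 - t * M2 ord0 ord0 - t * M3 ord0 ord0 + t ^+ 2 * M4 ord0 ord0.
  by rewrite !mxE; ring.
by rewrite E ug /bform; ring.
Qed.

(** Cauchy-Schwarz for the inner product of S, applied to u and S^-1 e_i. *)
Lemma posdef_ge (R : realType) (n : nat) (S : 'M[R]_n) : posdef S ->
  exists2 c : R, 0 < c & forall u, c * sqnorm u <= bform S u u.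
Proof.
move=> Spos; have [Ssym S_gt0] := Spos.
have Sfree : row_free S.
  apply: inj_row_free => v vS; apply: contrapT => /eqP v0.
  have := S_gt0 v^T; rewrite trmx_eq0 trmxK vS mul0mx mxE ltxx => /(_ v0).
  by [].
have Sunit : S \in unitmx by rewrite -row_free_unit.
pose g i : 'cV[R]_n := invmx S *m delta_mx i ord0.
have Sg i : S *m g i = delta_mx i ord0 by rewrite /g mulmxA mulmxV // mul1mx.
have g_gt0 i : 0 < bform S (g i) (g i).
  apply: S_gt0; apply/eqP => g0; have := Sg i; rewrite g0 mulmx0 => /matrixP/(_ i ord0).
  by rewrite !mxE !eqxx => /eqP; rewrite eq_sym oner_eq0.
have ug (u : 'cV[R]_n) i : bform S u (g i) = u i ord0 by rewrite /bform -mulmxA Sg -colE !mxE.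
have CS (u : 'cV[R]_n) i : u i ord0 ^+ 2 <= bform S (g i) (g i) * bform S u u.
  set p := bform S (g i) (g i); have p0 : 0 < p := g_gt0 i.
  have := bform_ge0 (u - (u i ord0 / p) *: g i) Spos.
  rewrite bform_pencil // ug -/p.
  have -> : bform S u u - 2 * (u i ord0 / p) * u i ord0 + (u i ord0 / p) ^+ 2 * p =
      bform S u u - u i ord0 ^+ 2 / p by field; rewrite gt_eqF.
  by rewrite subr_ge0 ler_pdivrMr // mulrC.
pose K := 1 + \sum_i bform S (g i) (g i).
have K0 : 0 < K by rewrite ltr_pwDl // sumr_ge0 // => i _; exact: ltW.
exists K^-1; first by rewrite invr_gt0.
move=> u; rewrite ler_pdivrMl // mulrDl mul1r ler_wpDl ?bform_ge0 //.
by rewrite mulr_suml; apply: ler_sum => i _; exact: CS.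
Qed.

(** * Integrals of signals *)

Definition hcont (R : realType) (f : R -> R) : Prop :=
  f x @[x --> 0^'+] --> f 0 /\ forall t : R, 0 < t -> {for t, continuous f}.

Lemma hcont_hderiv (R : realType) (f f' : R -> R) : hderiv f f' -> hcont f.
Proof.
move=> [cf df]; split=> // t t0; apply: differentiable_continuous.
by apply/derivable1_diffP; have [] := df t t0.
Qed.

Lemma hcontD (R : realType) (f g : R -> R) :
  hcont f -> hcont g -> hcont (fun t => f t + g t).
Proof.
move=> [f0 fc] [g0 gc]; split; first exact: cvgD.
by move=> t t0; apply: cvgD; [exact: fc|exact: gc].
Qed.

Lemma hcontM (R : realType) (f g : R -> R) :
  hcont f -> hcont g -> hcont (fun t => f t * g t).
Proof.
move=> [f0 fc] [g0 gc]; split; first exact: cvgM.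
by move=> t t0; apply: cvgM; [exact: fc|exact: gc].
Qed.

Lemma hcont_cst (R : realType) (c : R) : hcont (fun=> c).
Proof. by split=> [|t _]; exact: cvg_cst. Qed.

Lemma hcont_sum (R : realType) (I : Type) (r : seq I) (f : I -> R -> R) :
  (forall i, hcont (f i)) -> hcont (fun t => \sum_(i <- r) f i t).
Proof.
move=> fc; elim: r => [|i r IHr].
  by under eq_fun do rewrite big_nil; exact: hcont_cst.
by under eq_fun do rewrite big_cons; exact: hcontD.
Qed.

Lemma hcont_within (R : realType) (f : R -> R) (T : R) : hcont f -> 0 <= T ->
  {within `[0, T], continuous f}.
Proof.
move=> [f0 fc]; rewrite le_eqVlt => /predU1P[<-|T0].
  by rewrite set_itv1; exact: continuous_subspace1.
apply/continuous_within_itvP => //; split=> //.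
  by move=> x; rewrite in_itv /= => /andP[x0 _]; exact: fc.
exact: cvg_at_left_filter (fc _ T0).
Qed.

Lemma hcont_integrable (R : realType) (f : R -> R) (T : R) : hcont f -> 0 <= T ->
  lebesgue_measure.-integrable `[0, T] (EFin \o f).
Proof.
move=> fc T0; apply: continuous_compact_integrable; first exact: segment_compact.
exact: hcont_within.
Qed.

Lemma hcont_integral (R : realType) (f : R -> R) :
  (forall T : R, 0 <= T -> lebesgue_measure.-integrable `[0, T] (EFin \o f)) ->
  hcont (fun t => \int[lebesgue_measure]_(x in `[0, t]) f x).
Proof.
move=> fi; have cont (T : R) : 0 < T -> {within `[0, T], continuous
    (fun t => \int[lebesgue_measure]_(x in `[0, t]) f x)}.
  by move=> T0; apply: parameterized_integral_continuous; [exact: ltW|apply: fi; exact: ltW].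
split; first by have /(continuous_within_itvP _ ltr01)[] := cont 1 ltr01.
move=> t t0; have t10 : 0 < t + 1 by rewrite addr_gt0.
have /(continuous_within_itvP _ t10)[+ _ _] := cont _ t10; apply.
by rewrite in_itv /= t0 ltrDl ltr01.
Qed.

Lemma ae_mono (R : realType) (P Q : R -> Prop) : (forall t, P t -> Q t) ->
  {ae lebesgue_measure, forall t : R, P t} -> {ae lebesgue_measure, forall t : R, Q t}.
Proof.
move=> PQ; apply: filterS PQ; exact: (ae_filter_ringOfSetsType lebesgue_measure).
Qed.

(** The integrand only has to agree almost everywhere with a continuous g, which is
    how signals known up to null sets become differentiable. *)
Lemma hderiv_integral (R : realType) (f g : R -> R) :
  (forall T : R, 0 <= T -> lebesgue_measure.-integrable `[0, T] (EFin \o f)) ->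
  hcont g ->
  {ae lebesgue_measure, forall t : R, 0 <= t -> f t = g t} ->
  hderiv (fun t => \int[lebesgue_measure]_(x in `[0, t]) f x) g.
Proof.
move=> fi gc fg.
have eqint (t : R) : 0 <= t -> \int[lebesgue_measure]_(x in `[0, t]) g x =
    \int[lebesgue_measure]_(x in `[0, t]) f x.
  move=> t0; rewrite /Rintegral; congr fine; apply: ae_eq_integral; first exact: measurable_itv.
  - by have /integrableP[] := hcont_integrable gc t0.
  - by have /integrableP[] := fi t t0.
  - apply: ae_mono fg => x fgx; rewrite /= in_itv /= => /andP[x0 _].
    by rewrite fgx.
apply: (hderiv_ext eqint (fun _ _ => erefl)); split.
  by have [] := hcont_integral (fun T => hcont_integrable gc).
move=> t t0; have t1 : t < t + 1 by rewrite ltrDl.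
have t10 : 0 <= t + 1 by rewrite addr_ge0 // ltW.
have [d1 d2] := continuous_FTC1_closed t1 (hcont_integrable gc t10) t0 (gc.2 t t0).
by apply: DeriveDef => //; rewrite -derive1E.
Qed.

Definition mcont (R : realType) (m n : nat) (F : R -> 'M[R]_(m, n)) : Prop :=
  forall i j, hcont (fun t => F t i j).

Lemma mcont_mderiv (R : realType) (m n : nat) (F F' : R -> 'M[R]_(m, n)) :
  mderiv F F' -> mcont F.
Proof. by move=> dF i j; exact: hcont_hderiv (dF i j). Qed.

Lemma mcontM (R : realType) (m n p : nat) (F : R -> 'M[R]_(m, n)) (G : R -> 'M[R]_(n, p)) :
  mcont F -> mcont G -> mcont (fun t => F t *m G t).
Proof.
move=> cF cG i j; under eq_fun do rewrite mxE.
by apply: hcont_sum => k; exact: hcontM.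
Qed.

Lemma mcont_cst (R : realType) (m n : nat) (A : 'M[R]_(m, n)) : mcont (fun=> A).
Proof. by move=> i j; exact: hcont_cst. Qed.

Lemma mcontD (R : realType) (m n : nat) (F G : R -> 'M[R]_(m, n)) :
  mcont F -> mcont G -> mcont (fun t => F t + G t).
Proof. by move=> cF cG i j; under eq_fun do rewrite mxE; exact: hcontD. Qed.

Lemma variation_of_constants (R : realType) (m n : nat) (A : 'M[R]_m)
    (u : R -> 'M[R]_(m, n)) : mcont u ->
  exists2 y : R -> 'M[R]_(m, n), mderiv y (fun t => A *m y t + u t) & y 0 = 0.
Proof.
move=> uc; pose v t := expmx (t *: - A) *m u t.
have vc : mcont v by apply: mcontM => //; exact: mcont_mderiv (mderiv_expmx _).
pose V t : 'M[R]_(m, n) := \matrix_(i, j) \int[lebesgue_measure]_(x in `[0, t]) v x i j.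
have dV : mderiv V v.
  move=> i j; rewrite /V; under eq_fun do rewrite mxE.
  apply: hderiv_integral => //; first by move=> T; exact: hcont_integrable.
  by apply: aeW.
exists (fun t => expmx (t *: A) *m V t).
  apply: mderiv_ext (mderivM (mderiv_expmx A) dV) => // t t0.
  by rewrite /v [in X in _ + X]mulmxA expmx_inv ?ltW // mul1mx mulmxA.
rewrite (_ : V 0 = 0) ?mulmx0 //; apply/matrixP => i j; rewrite !mxE.
by rewrite set_itv1 Rintegral_set1.
Qed.

(** * Trajectories of the loop *)

Lemma mulmx_row_col (R : realType) (m n p l : nat) (X : 'M[R]_(m, n)) (Y : 'M[R]_(n, p))
    (Z : 'M[R]_(p, l)) i j :
  (row i X *m Y *m col j Z) ord0 ord0 = (X *m Y *m Z) i j.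
Proof.
rewrite -row_mul [LHS]mxE [RHS]mxE; apply: eq_bigr => h _; congr (_ * _).
  by rewrite [LHS]mxE.
by rewrite mxE.
Qed.

Lemma kernel_scalar (R : realType) (q s r : R) (k : nat) (Delta : lti R k k) (N : nat)
    (a b : {poly R}) (u : R) : scalar_realization q s r Delta N a b ->
  lti_C Delta *m expmx (u *: lti_A Delta) *m lti_B Delta =
  ((comp_C N a b *m expmx (u *: comp_A N a) *m comp_B N) ord0 ord0)%:M.
Proof.
move=> sr; apply/matrixP => i j.
rewrite -mulmx_row_col expmx_bilin mxE expmx_bilin.
have coefE p : exp_coef (row i (lti_C Delta)) (lti_A Delta) (col j (lti_B Delta)) p =
    exp_coef (comp_C N a b) (comp_A N a) (comp_B N) p *+ (i == j).
  by rewrite /exp_coef mulmx_row_col (sr_markov sr) mxE mulrnAr.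
case: eqP coefE => _ coefE.
  by rewrite mulr1n; congr (limn (pseries _ u)); apply/funext => p; rewrite coefE mulr1n.
rewrite mulr0n; apply: lim_near_cst => //; near=> p.
by rewrite /pseries /series /= big1 // => d _; rewrite coefE mulr0n mul0r.
Unshelve. all: by end_near.
Qed.

Lemma L2e_integrable (R : realType) (n : nat) (z : R -> 'cV[R]_n) (i : 'I_n) (T : R) :
  L2e z -> 0 <= T -> lebesgue_measure.-integrable `[0, T] (EFin \o (fun t => z t i ord0)).
Proof.
move=> /(_ i)[zm z2] T0.
have cst1 : lebesgue_measure.-integrable `[0, T] (EFin \o (fun=> 1 : R)).
  by apply: hcont_integrable => //; exact: hcont_cst.
have bound : lebesgue_measure.-integrable `[0, T]
    ((EFin \o (fun=> 1%R : R)) \+ (fun t => (z t i ord0 ^+ 2)%:E))%E.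
  by apply: integrableD => //; exact: z2.
apply: (le_integrable _ _ _ bound) => //.
- apply/measurable_EFinP; apply: measurable_funS zm => //.
  by move=> x; rewrite /= !in_itv /= => /andP[-> _].
- move=> x _ /=; rewrite lee_fin [leRHS]ger0_norm ?addr_ge0 ?sqr_ge0 //.
  by set y := z x i ord0; rewrite ler_norml; apply/andP; split; nra.
Qed.

Lemma integrableM_hcont (R : realType) (f g : R -> R) (T : R) :
  lebesgue_measure.-integrable `[0, T] (EFin \o f) -> hcont g -> 0 <= T ->
  lebesgue_measure.-integrable `[0, T] (EFin \o (fun t => f t * g t)).
Proof.
move=> fi gc T0.
have gm : measurable_fun `[0, T] g.
  by have /integrableP[/measurable_EFinP] := hcont_integrable gc T0.
apply: (integrableMl _ fi gm) => //.
have [M [Mreal Mg]] := compact_bounded (continuous_compact (hcont_within gc T0) (@segment_compact R 0 T)).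
by exists M; split=> // y My x xT; apply: Mg => //; exists x.
Qed.

Lemma hcont_ext (R : realType) (f g : R -> R) :
  (forall t, 0 <= t -> f t = g t) -> hcont f -> hcont g.
Proof.
move=> fg [f0 fc]; split.
  rewrite -fg //; apply: cvg_trans f0; apply: near_eq_cvg.
  by near=> x; apply: fg; apply: ltW; near: x; exact: nbhs_right_gt.
move=> t t0; suff : g x @[x --> t] --> g t by [].
rewrite -(fg t (ltW t0)); apply: cvg_trans (fc t t0).
apply: near_eq_cvg; near=> x; apply: fg; apply: ltW; near: x; exact: lt_nbhsr.
Unshelve. all: by end_near.
Qed.

Lemma Rintegral_lincomb (R : realType) (N : nat) (T : R) (c : 'I_N -> R) (f : 'I_N -> R -> R) :
  (forall j, lebesgue_measure.-integrable `[0, T] (EFin \o f j)) ->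
  \int[lebesgue_measure]_(t in `[0, T]) (\sum_j c j * f j t) =
  \sum_j c j * \int[lebesgue_measure]_(t in `[0, T]) f j t.
Proof.
move=> fi.
have split_sum (r : seq 'I_N) :
    lebesgue_measure.-integrable `[0, T] (EFin \o (fun t => \sum_(j <- r) c j * f j t)) /\
    \int[lebesgue_measure]_(t in `[0, T]) (\sum_(j <- r) c j * f j t) =
    \sum_(j <- r) c j * \int[lebesgue_measure]_(t in `[0, T]) f j t.
  elim: r => [|j r [IHi IHe]].
    have s0 : (fun t : R => \sum_(j <- [::]) c j * f j t) = fun=> 0.
      by apply/funext => t; rewrite big_nil.
    split; rewrite s0; first exact: integrable0.
    by rewrite big_nil Rintegral_cst ?mul0r //; exact: measurable_itv.
  have cfi : lebesgue_measure.-integrable `[0, T] (EFin \o (fun t => c j * f j t)).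
    exact: (integrableZl _ (c j) (fi j)).
  have sj : (fun t : R => \sum_(j <- j :: r) c j * f j t) =
      (fun t => c j * f j t + \sum_(j <- r) c j * f j t).
    by apply/funext => t; rewrite big_cons.
  split; rewrite sj; first exact: (integrableD _ cfi IHi).
  by rewrite big_cons -IHe -RintegralZl // RintegralD.
by have [] := split_sum (index_enum 'I_N).
Qed.

(** All N + 1 derivatives recovered from the state H, the first N of them, and from
    the input z. *)
Definition ext_state (R : realType) (k N : nat) (a : {poly R}) (H : 'M[R]_(k, N))
    (z : 'cV[R]_k) : 'M[R]_(k, N.+1) :=
  H *m (ext_rows N a)^T + z *m (last_unit N)^T.

Section ExtState.
Variables (R : realType) (k N : nat) (a : {poly R}) (H : 'M[R]_(k, N)) (z : 'cV[R]_k).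

Lemma ext_state_init : ext_state a H z *m (init_rows N)^T = H.
Proof.
rewrite mulmxDl -!mulmxA -!trmx_mul init_ext init_last trmx1 mulmx1 trmx0 mulmx0.
by rewrite addr0.
Qed.

Lemma ext_state_tail :
  ext_state a H z *m (tail_rows N)^T = H *m (comp_A N a)^T + z *m (comp_B N)^T.
Proof. by rewrite mulmxDl -!mulmxA -!trmx_mul. Qed.

Lemma ext_state_den : a \is monic -> size a = N.+1 -> ext_state a H z *m coef_col N a = z.
Proof.
move=> a_monic sa; rewrite mulmxDl -!mulmxA -[coef_col N a]trmxK -!trmx_mul.
rewrite coef_ext // coef_last.
have -> : a`_N = 1 by move/monicP: a_monic; rewrite lead_coefE sa.
by rewrite trmx0 mulmx0 add0r tr_scalar_mx mulmx1.
Qed.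

Lemma ext_state_num (b : {poly R}) :
  ext_state a H z *m coef_col N b = H *m (comp_C N a b)^T + b`_N *: z.
Proof.
rewrite mulmxDl -!mulmxA -[coef_col N b]trmxK -!trmx_mul coef_last.
by rewrite tr_scalar_mx mul_mx_scalar.
Qed.

End ExtState.

Section Trajectory.
Variables (R : realType) (n k N : nat).
Variables (A : 'M[R]_n) (B : 'M[R]_(n, k)) (C : 'M[R]_(k, n)) (D : 'M[R]_k).
Variables (q s r : R) (Delta : lti R k k) (a b : {poly R}).
Hypothesis sr : scalar_realization q s r Delta N a b.

Let d := b`_N.
Let Ac := comp_A N a.
Let phi (t : R) : 'cV[R]_N := expmx (t *: - Ac) *m comp_B N.

(** Variation of constants for the k copies of the companion realisation; the
    factor e^(tA) that depends on t is left out, so that the integrand does not. *)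
Definition conv_core (z : R -> 'cV[R]_k) (t : R) : 'M[R]_(k, N) :=
  \matrix_(i, j) \int[lebesgue_measure]_(u in `[0, t]) (z u i ord0 * phi u j ord0).

Definition delta_state (z : R -> 'cV[R]_k) (t : R) : 'M[R]_(k, N) :=
  conv_core z t *m (expmx (t *: Ac))^T.

Lemma phi_cont j : hcont (fun t => phi t j ord0).
Proof.
exact: (mcontM (mcont_mderiv (mderiv_expmx (- Ac))) (mcont_cst (comp_B N))).
Qed.

Lemma conv_integrable (z : R -> 'cV[R]_k) (i : 'I_k) (j : 'I_N) (T : R) :
  L2e z -> 0 <= T ->
  lebesgue_measure.-integrable `[0, T] (EFin \o (fun u => z u i ord0 * phi u j ord0)).
Proof.
by move=> zL T0; apply: integrableM_hcont => //; [exact: L2e_integrable|exact: phi_cont].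
Qed.

Lemma conv_core_cont (z : R -> 'cV[R]_k) : L2e z -> mcont (conv_core z).
Proof.
move=> zL i j; rewrite /conv_core; under eq_fun do rewrite mxE.
by apply: hcont_integral => T T0; exact: conv_integrable.
Qed.

(** The kernel e^((t-u)A) splits as e^(tA) e^(-uA). *)
Lemma lti_map_state (z : R -> 'cV[R]_k) (t : R) : L2e z -> 0 <= t ->
  lti_map Delta z t = delta_state z t *m (comp_C N a b)^T + d *: z t.
Proof.
move=> zL t0; rewrite /lti_map (sr_feed sr) mul_scalar_mx; congr (_ + _).
apply/matrixP => i j; rewrite ord1 {j} mxE.
pose c := comp_C N a b *m expmx (t *: Ac).
transitivity (\int[lebesgue_measure]_(u in `[0, t])
    (\sum_j c ord0 j * (z u i ord0 * phi u j ord0))).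
  apply: eq_Rintegral => u; rewrite inE /= in_itv /= => /andP[u0 _].
  rewrite (kernel_scalar _ sr) mul_scalar_mx mxE -/Ac.
  have -> : expmx ((t - u) *: Ac) = expmx (t *: Ac) *m expmx (u *: - Ac).
    by rewrite -[t in RHS](subrK u) expmx_sub.
  rewrite mulmxA -[_ *m _ *m comp_B N]mulmxA -/c -/(phi u) mxE mulr_suml.
  by apply: eq_bigr => h _; ring.
rewrite Rintegral_lincomb; last by move=> j; exact: conv_integrable.
rewrite /delta_state -mulmxA -trmx_mul -/c mxE; apply: eq_bigr => h _.
by rewrite !mxE mulrC.
Qed.

(** Because the feedthrough loop is well posed, z equals almost everywhere a linear
    function zt of the continuous signals x and H.  Replacing z by zt in the
    integrals that define x and H makes these differentiable. *)
Lemma trajectory_ode (x : R -> 'cV[R]_n) : \det (1%:M - d *: D) != 0 ->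
  trajectory A B C D Delta x ->
  exists K : R -> 'M[R]_(k, N.+1),
    [/\ mcont K,
        mderiv (fun t => K t *m (init_rows N)^T) (fun t => K t *m (tail_rows N)^T),
        K 0 *m (init_rows N)^T = 0,
        mderiv x (fun t => A *m x t + B *m (K t *m coef_col N b)) &
        forall t, 0 <= t -> K t *m coef_col N a = C *m x t + D *m (K t *m coef_col N b)].
Proof.
move=> wp [dx [w [z [zL [[dxi xE] dyn]]]]].
have a_monic := sr_monic sr; have sa := sr_size_den sr.
have wpu : 1%:M - d *: D \in unitmx by rewrite unitmxE unitfE.
pose H := delta_state z.
pose zt t : 'cV[R]_k :=
  invmx (1%:M - d *: D) *m (C *m x t + D *m (H t *m (comp_C N a b)^T)).
pose K t := ext_state a (H t) (zt t).
have Kinit t : K t *m (init_rows N)^T = H t := ext_state_init a (H t) (zt t).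
have Ktail t : K t *m (tail_rows N)^T = H t *m Ac^T + zt t *m (comp_B N)^T.
  exact: ext_state_tail.
have Ka t : K t *m coef_col N a = zt t by exact: ext_state_den.
have Kb t : K t *m coef_col N b = H t *m (comp_C N a b)^T + d *: zt t.
  exact: ext_state_num.
have ztE t : zt t = C *m x t + D *m (K t *m coef_col N b).
  have : (1%:M - d *: D) *m zt t = C *m x t + D *m (H t *m (comp_C N a b)^T).
    by rewrite /zt mulKVmx.
  rewrite mulmxBl mul1mx => /(canRL (subrK _)) ->; rewrite Kb mulmxDr addrA.
  by rewrite -scalemxAl -scalemxAr.
have xc : mcont x.
  move=> i j; rewrite ord1; apply: (@hcont_ext R (fun t => x 0 i ord0 + vint 0 t dx i ord0)).
    by move=> t t0; rewrite [in RHS]xE // [RHS]mxE.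
  apply: hcontD; first exact: hcont_cst.
  by under eq_fun do rewrite mxE; apply: hcont_integral => T T0; exact: dxi.
have Hc : mcont H.
  have Ec := mcont_mderiv (mderiv_tr (mderiv_expmx Ac)).
  exact: mcontM (conv_core_cont zL) Ec.
have ztc : mcont zt.
  exact: (mcontM (mcont_cst _) (mcontD (mcontM (mcont_cst C) xc)
    (mcontM (mcont_cst D) (mcontM Hc (mcont_cst _))))).
have Kc : mcont K.
  exact: (mcontD (mcontM Hc (mcont_cst _)) (mcontM ztc (mcont_cst _))).
have ae_eqs : {ae lebesgue_measure, forall t : R, 0 <= t ->
    z t = zt t /\ dx t = A *m x t + B *m (K t *m coef_col N b)}.
  apply: ae_mono dyn => t eqs t0; have [io wE] := eqs t0.
  move: io; rewrite mul_block_col => /eq_col_mx[dxE zE].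
  have {}wE : w t = H t *m (comp_C N a b)^T + d *: z t by rewrite wE lti_map_state.
  have zzt : z t = zt t.
    rewrite /zt -[LHS](mulKmx wpu); congr (_ *m _).
    rewrite mulmxBl mul1mx -scalemxAl scalemxAr {1}zE wE mulmxDr addrA.
    by rewrite addrK.
  by split=> //; rewrite dxE wE Kb zzt.
have dJ : mderiv (conv_core z) (fun t => zt t *m (phi t)^T).
  move=> i j; rewrite /conv_core; under eq_fun do rewrite mxE.
  apply: hderiv_integral; first by move=> T T0; exact: conv_integrable.
    have phiTc : mcont (fun t => (phi t)^T).
      by move=> l1 l2; under eq_fun do rewrite mxE; rewrite ord1; exact: phi_cont.
    exact: (mcontM ztc phiTc i j).
  apply: ae_mono ae_eqs => t eqs t0; have [-> _] := eqs t0.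
  by rewrite [RHS]mxE big_ord1 [(phi t)^T _ _]mxE.
exists K; split=> //.
- apply: mderiv_ext (mderivM dJ (mderiv_tr (mderiv_expmx Ac))) => t t0; first by rewrite Kinit.
  rewrite Ktail /H /delta_state -[_ *m _ *m Ac^T]mulmxA -trmx_mul [RHS]addrC.
  congr (_ + _); rewrite -mulmxA -trmx_mul /phi mulmxA expmx_inv ?ltW //.
  by rewrite mul1mx.
- rewrite Kinit /H /delta_state (_ : conv_core z 0 = 0) ?mul0mx //.
  by apply/matrixP => i j; rewrite !mxE set_itv1 Rintegral_set1.
- move=> i j; rewrite ord1.
  apply: (@hderiv_ext R (fun t => x 0 i ord0 + vint 0 t dx i ord0) _
    (fun t => 0 + (A *m x t + B *m (K t *m coef_col N b)) i ord0)).
  + by move=> t t0; rewrite [in RHS]xE // [RHS]mxE.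
  + by move=> t _; rewrite add0r.
  apply: hderivD; first exact: hderiv_cst.
  under eq_fun do rewrite mxE; apply: hderiv_integral.
  + by move=> T T0; exact: dxi.
  + exact: (mcontD (mcontM (mcont_cst A) xc)
      (mcontM (mcont_cst B) (mcontM Kc (mcont_cst (coef_col N b)))) i ord0).
  + by apply: ae_mono ae_eqs => t eqs t0; have [_ ->] := eqs t0.
- by move=> t _; rewrite Ka ztE.
Qed.

End Trajectory.

(** * The matrix inequalities as quadratic forms *)

Lemma bformDr (R : realType) (n : nat) (S : 'M[R]_n) (u v w : 'cV[R]_n) :
  bform S u (v + w) = bform S u v + bform S u w.
Proof. by rewrite /bform mulmxDr mxE. Qed.

Lemma bformZr (R : realType) (n : nat) (S : 'M[R]_n) (x : R) (u v : 'cV[R]_n) :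
  bform S u (x *: v) = x * bform S u v.
Proof. by rewrite /bform -scalemxAr mxE. Qed.

Lemma bform0l (R : realType) (n : nat) (S : 'M[R]_n) (v : 'cV[R]_n) : bform S 0 v = 0.
Proof. by rewrite /bform trmx0 !mul0mx mxE. Qed.

Lemma bform0r (R : realType) (n : nat) (S : 'M[R]_n) (v : 'cV[R]_n) : bform S v 0 = 0.
Proof. by rewrite /bform mulmx0 mxE. Qed.

Lemma bformDS (R : realType) (n : nat) (S T : 'M[R]_n) (u v : 'cV[R]_n) :
  bform (S + T) u v = bform S u v + bform T u v.
Proof. by rewrite /bform mulmxDr mulmxDl mxE. Qed.

Lemma bformNS (R : realType) (n : nat) (S : 'M[R]_n) (u v : 'cV[R]_n) :
  bform (- S) u v = - bform S u v.
Proof. by rewrite /bform mulmxN mulNmx mxE. Qed.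

Lemma bform_congruence (R : realType) (m n : nat) (S : 'M[R]_m) (H : 'M[R]_(m, n))
    (u v : 'cV[R]_n) : bform (H^T *m S *m H) u v = bform S (H *m u) (H *m v).
Proof. by rewrite /bform trmx_mul !mulmxA. Qed.

Lemma bform_block (R : realType) (m n : nat) (S11 : 'M[R]_m) (S12 : 'M[R]_(m, n))
    (S21 : 'M[R]_(n, m)) (S22 : 'M[R]_n) (u1 v1 : 'cV[R]_m) (u2 v2 : 'cV[R]_n) :
  bform (block_mx S11 S12 S21 S22) (col_mx u1 u2) (col_mx v1 v2) =
  bform S11 u1 v1 + (u1^T *m S12 *m v2) ord0 ord0 +
  (u2^T *m S21 *m v1) ord0 ord0 + bform S22 u2 v2.
Proof.
rewrite /bform tr_col_mx mul_row_block mul_row_col !mulmxDl.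
have E (M1 M2 M3 M4 : 'M[R]_1) : (M1 + M2 + (M3 + M4)) ord0 ord0 =
    M1 ord0 ord0 + M3 ord0 ord0 + M2 ord0 ord0 + M4 ord0 ord0 by rewrite !mxE; ring.
exact: E.
Qed.

Lemma bform_kron (R : realType) (m : nat) (q s r : R) (M : 'M[R]_m)
    (u1 u2 v1 v2 : 'cV[R]_m) :
  bform (kron2 (sym2 q s r) M) (col_mx u1 u2) (col_mx v1 v2) =
  q * bform M u1 v1 + s * (bform M u1 v2 + bform M u2 v1) + r * bform M u2 v2.
Proof.
have e00 : sym2 q s r ord0 ord0 = q.
  transitivity (sym2 q s r (lshift 1 ord0) (lshift 1 ord0)).
    by congr (sym2 _ _ _ _ _); apply: val_inj.
  by rewrite block_mxEul mxE mulr1n.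
have e01 : sym2 q s r ord0 ord_max = s.
  transitivity (sym2 q s r (lshift 1 ord0) (rshift 1 ord0)).
    by congr (sym2 _ _ _ _ _); apply: val_inj.
  by rewrite block_mxEur mxE mulr1n.
have e10 : sym2 q s r ord_max ord0 = s.
  transitivity (sym2 q s r (rshift 1 ord0) (lshift 1 ord0)).
    by congr (sym2 _ _ _ _ _); apply: val_inj.
  by rewrite block_mxEdl mxE mulr1n.
have e11 : sym2 q s r ord_max ord_max = r.
  transitivity (sym2 q s r (rshift 1 ord0) (rshift 1 ord0)).
    by congr (sym2 _ _ _ _ _); apply: val_inj.
  by rewrite block_mxEdr mxE mulr1n.
rewrite /kron2 e00 e01 e10 e11 bform_block /bform -!scalemxAr -!scalemxAl.
by rewrite !mxE; ring.
Qed.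

Section LMI.
Variables (R : realType) (n k np mp : nat).
Variables (A : 'M[R]_n) (B : 'M[R]_(n, k)) (C : 'M[R]_(k, n)) (D : 'M[R]_k).
Variables (q s r : R).
Variables (Ap : 'M[R]_np) (Bp : 'M[R]_(np, k)) (Cp : 'M[R]_(mp, np)) (Dp : 'M[R]_(mp, k)).
Variables (X : 'M[R]_(np + np + n)) (Y : 'M[R]_np) (M : 'M[R]_mp).

Definition filter_form : 'M[R]_(np + k) :=
  (col_mx (row_mx 1%:M 0) (row_mx Ap Bp))^T *m block_mx 0 Y Y 0
    *m col_mx (row_mx 1%:M 0) (row_mx Ap Bp)
  + (row_mx Cp Dp)^T *m M *m row_mx Cp Dp.

Definition loop_form : 'M[R]_(np + np + n + k) :=
  (lmi_H A B C D Ap Bp Cp Dp)^T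
    *m block_mx (block_mx 0 X X 0) 0 0 (kron2 (sym2 q s r) M)
    *m lmi_H A B C D Ap Bp Cp Dp.

(** The derivative of the form Y along the filter, plus the form M of its output. *)
Lemma filter_formE (xi1 xi2 : 'cV[R]_np) (z1 z2 : 'cV[R]_k) :
  bform filter_form (col_mx xi1 z1) (col_mx xi2 z2) =
  bform Y xi1 (Ap *m xi2 + Bp *m z2) + bform Y (Ap *m xi1 + Bp *m z1) xi2 +
  bform M (Cp *m xi1 + Dp *m z1) (Cp *m xi2 + Dp *m z2).
Proof.
rewrite /filter_form bformDS !bform_congruence !mul_col_mx !mul_row_col !mul1mx !mul0mx !addr0.
rewrite bform_block /bform !mulmx0 !mul0mx.
have z00 : (0 : 'M[R]_1) ord0 ord0 = 0 by rewrite mxE.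
by rewrite !z00 add0r addr0.
Qed.

Lemma loop_formE (xi1 xi2 : 'cV[R]_np) (x : 'cV[R]_n) (w : 'cV[R]_k) :
  let z := C *m x + D *m w in
  let u := col_mx (col_mx xi1 xi2) x in
  let du := col_mx (col_mx (Ap *m xi1 + Bp *m z) (Ap *m xi2 + Bp *m w)) (A *m x + B *m w) in
  let y1 := Cp *m xi1 + Dp *m z in let y2 := Cp *m xi2 + Dp *m w in
  bform loop_form (col_mx u w) (col_mx u w) =
  bform X u du + bform X du u +
  (q * bform M y1 y1 + s * (bform M y1 y2 + bform M y2 y1) + r * bform M y2 y2).
Proof.
move=> z u du y1 y2; rewrite /loop_form bform_congruence.
have bdiag p (J : 'M[R]_(p, np)) (L : 'M[R]_(p, k)) :
    bdiag2 J *m col_mx xi1 xi2 + bdiag2 L *m col_mx C 0 *m x + bdiag2 L *m col_mx D 1%:M *m w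
    = col_mx (J *m xi1 + L *m z) (J *m xi2 + L *m w).
  rewrite /bdiag2 -!mulmxA [col_mx C 0 *m x]mul_col_mx [col_mx D 1%:M *m w]mul_col_mx
    !mul0mx mul1mx !mul_block_col !mul0mx !mulmx0.
  by rewrite !addr0 !add0r !add_col_mx addr0 -addrA -mulmxDr.
have -> : lmi_H A B C D Ap Bp Cp Dp *m col_mx u w = col_mx (col_mx u du) (col_mx y1 y2).
  have row3 p (P : 'M[R]_(p, np + np)) (Q : 'M[R]_(p, n)) (T : 'M[R]_(p, k)) :
      row_mx (row_mx P Q) T *m col_mx u w = P *m col_mx xi1 xi2 + Q *m x + T *m w.
    by rewrite /u !mul_row_col.
  rewrite /lmi_H /= mul_col_mx row3 bdiag; congr col_mx.
  rewrite mul_col_mx; congr col_mx; rewrite mul_col_mx !row3 ?bdiag.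
    by rewrite !mul1mx !mul0mx !addr0 add0r.
  by rewrite mul0mx add0r.
rewrite bform_block bform_kron bform_block /bform !mulmx0 !mul0mx.
have z00 : (0 : 'M[R]_1) ord0 ord0 = 0 by rewrite mxE.
by rewrite !z00 !addr0 add0r.
Qed.

End LMI.

(** * Well-posedness *)

Lemma negdef_bform (R : realType) (n : nat) (S : 'M[R]_n) (u : 'cV[R]_n) :
  negdef S -> u != 0 -> bform S u u < 0.
Proof.
by move=> [_ S_lt0] /S_lt0; rewrite mulmxN mulNmx mxE oppr_gt0.
Qed.

(** At frequency infinity the filter state and the plant state drop out of both
    inequalities and only the feedthroughs D and Dp are left. *)
Lemma lmi_well_posed (R : realType) (n k np mp : nat)
    (A : 'M[R]_n) (B : 'M[R]_(n, k)) (C : 'M[R]_(k, n)) (D : 'M[R]_k) (q s r : R)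
    (Ap : 'M[R]_np) (Bp : 'M[R]_(np, k)) (Cp : 'M[R]_(mp, np)) (Dp : 'M[R]_(mp, k))
    (X : 'M[R]_(np + np + n)) (Y : 'M[R]_np) (M : 'M[R]_mp) (W : 'M[R[i]]_k) :
  M^T = M -> posdef (filter_form Ap Bp Cp Dp Y M) ->
  negdef (loop_form A B C D q s r Ap Bp Cp Dp X M) ->
  repeated_scalars k (sym2 q s r) W -> \det (1%:M - cmx D *m W) != 0.
Proof.
move=> Msym Spos Lneg /repeated_scalarsP[x [y [-> xy_ge0]]].
pose mu (u v : 'cV[R]_k) := bform M (Dp *m u) (Dp *m v).
have mu_ge0 u : 0 <= mu u u.
  have := bform_ge0 (col_mx (0 : 'cV_np) u) Spos.
  by rewrite filter_formE !mulmx0 !add0r bform0l bform0r !add0r.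
have mu_neg (w : 'cV[R]_k) : w != 0 -> q * mu (D *m w) (D *m w) +
    s * (mu (D *m w) w + mu w (D *m w)) + r * mu w w < 0.
  move=> w0; have v0 : col_mx (col_mx (col_mx (0 : 'cV_np) (0 : 'cV_np)) (0 : 'cV_n)) w != 0.
    apply: contraNneq w0; rewrite -[X in _ = X]col_mx0 => /eq_col_mx[_ ->] //.
  have := negdef_bform Lneg v0; rewrite loop_formE !mulmx0 !add0r !col_mx0.
  by rewrite bform0l bform0r !add0r.
have mu_le w : q * mu (D *m w) (D *m w) +
    s * (mu (D *m w) w + mu w (D *m w)) + r * mu w w <= 0.
  have [->|/mu_neg/ltW //] := eqVneq w 0.
  by rewrite /mu !mulmx0 !bform0l !mulr0 !addr0 mulr0.
apply/negP; rewrite -det_tr => /det0P[v v0 vW].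
pose zeta := v^T.
have zetaE : zeta = cmx D *m (Complex x y *: zeta).
  have := congr1 trmx vW; rewrite trmx_mul trmxK trmx0 mulmxBl mul1mx -mulmxA mul_scalar_mx.
  by move/eqP; rewrite subr_eq0 => /eqP.
pose z1 := map_mx (@complex.Re R) zeta; pose z2 := map_mx (@complex.Im R) zeta.
pose w1 := x *: z1 - y *: z2; pose w2 := x *: z2 + y *: z1.
have w1E : map_mx (@complex.Re R) (Complex x y *: zeta) = w1.
  by apply/matrixP => i j; rewrite !mxE; case: (v j i) => a b; simpc.
have w2E : map_mx (@complex.Im R) (Complex x y *: zeta) = w2.
  by apply/matrixP => i j; rewrite !mxE; case: (v j i) => a b; simpc.
have Dw1 : D *m w1 = z1 by rewrite -w1E -Re_cmx_mul -zetaE.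
have Dw2 : D *m w2 = z2 by rewrite -w2E -Im_cmx_mul -zetaE.
have muC u t : mu u t = mu t u by exact: bformC.
have mur u c1 v1 c2 v2 : mu u (c1 *: v1 + c2 *: v2) = c1 * mu u v1 + c2 * mu u v2.
  by rewrite /mu mulmxDr -!scalemxAr bformDr !bformZr.
have mu1 u : mu u w1 = x * mu u z1 - y * mu u z2 by rewrite /w1 -scaleNr mur mulNr.
have mu2 u : mu u w2 = x * mu u z2 + y * mu u z1 by exact: mur.
have total : q * mu z1 z1 + s * (mu z1 w1 + mu w1 z1) + r * mu w1 w1 +
    (q * mu z2 z2 + s * (mu z2 w2 + mu w2 z2) + r * mu w2 w2) =
    (q + 2 * s * x + r * (x ^+ 2 + y ^+ 2)) * (mu z1 z1 + mu z2 z2).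
  rewrite (mu1 w1) (mu2 w2) [mu w1 z1]muC [mu w1 z2]muC [mu w2 z1]muC [mu w2 z2]muC.
  rewrite !mu1 !mu2 [mu z2 z1]muC; ring.
have ge0 := mulr_ge0 xy_ge0 (addr_ge0 (mu_ge0 z1) (mu_ge0 z2)).
have := mu_le w1; have := mu_le w2; rewrite Dw1 Dw2 => le2 le1.
have [w1_0|/mu_neg] := eqVneq w1 0; last by rewrite Dw1; lra.
have [w2_0|/mu_neg] := eqVneq w2 0; last by rewrite Dw2; lra.
case/negP: v0; apply/eqP/matrixP => i j; rewrite mxE.
have := congr1 (fun P : 'cV[R]_k => P j ord0) Dw1; have := congr1 (fun P : 'cV[R]_k => P j ord0) Dw2.
rewrite w1_0 w2_0 !mulmx0 !mxE (ord1 i); case: (v 0 j) => a b /= <- <-.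
by [].
Qed.

(** * The Lyapunov function of the loop *)

Lemma hderiv_bform (R : realType) (n : nat) (S : 'M[R]_n) (u u' : R -> 'cV[R]_n) :
  mderiv u u' ->
  hderiv (fun t => bform S (u t) (u t)) (fun t => bform S (u' t) (u t) + bform S (u t) (u' t)).
Proof.
move=> du; apply: hderiv_ext (mderivM (mderiv_mulr S (mderiv_tr du)) du ord0 ord0) => // t _.
by rewrite mxE.
Qed.

(** f is dominated by the decrease of W, so f spends little time away from 0,
    and f + kappa W is nonincreasing, so f cannot come back. *)
Lemma dissipated_cvg0 (R : realType) (f f' W W' : R -> R) (eps kappa : R) :
  0 < eps -> 0 < kappa -> hderiv f f' -> hderiv W W' ->
  (forall t : R, 0 <= t -> 0 <= f t) -> (forall t : R, 0 <= t -> 0 <= W t) ->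
  (forall t : R, 0 < t -> W' t <= - eps * f t) ->
  (forall t : R, 0 < t -> f' t + kappa * W' t <= 0) ->
  f t @[t --> +oo] --> (0 : R).
Proof.
move=> eps0 kappa0 df dW f_ge0 W_ge0 W'_le fW'; apply/cvgr0Pnorm_le => e e0.
pose Wset : set R := image [set t : R | 0 <= t]%classic W.
have Winf : has_inf Wset.
  by split; [exists (W 0), 0 => //=|exists 0 => _ [t t0 <-]; exact: W_ge0].
have Wlb t : 0 <= t -> inf Wset <= W t.
  by move=> t0; apply: ge_inf; [exact: Winf.2|exists t].
have ek0 : 0 < e / (2 * kappa) by rewrite divr_gt0 ?mulr_gt0.
have [_ [s0 /= s0_ge0 <-] Ws0] := inf_adherent ek0 Winf.
have Wmono u v : 0 <= u -> u <= v -> W v <= W u.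
  move=> u0 uv; apply: (hderiv_le dW) => // t ut; have t0 : 0 < t := le_lt_trans u0 ut.
  apply: le_trans (W'_le t t0) _; rewrite mulNr oppr_le0.
  by apply: mulr_ge0; [exact: ltW|apply: f_ge0; exact: ltW].
have [s1 s01 fs1] : exists2 s1, s0 <= s1 & f s1 <= e / 2.
  apply: contrapT => none.
  have f_gt t : s0 <= t -> e / 2 < f t.
    by move=> st; rewrite ltNge; apply/negP => ft; apply: none; exists t.
  pose t1 := s0 + (W s0 + 1) / (eps * (e / 2)).
  have ee : 0 < eps * (e / 2) by rewrite mulr_gt0 ?divr_gt0.
  have st1 : s0 <= t1 by rewrite lerDl divr_ge0 ?addr_ge0 ?W_ge0 // ltW.
  have dlin : hderiv (fun t => eps * (e / 2) * t) (fun=> eps * (e / 2)).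
    apply: hderiv_of_deriv => u; have := is_deriveZ (eps * (e / 2)) (is_derive_id u (1 : R)).
    by move=> H; apply: is_derive_eq H _; rewrite /GRing.scale /= mulr1.
  have H u : s0 < u -> W' u + eps * (e / 2) <= 0.
    move=> su; have u0 : 0 < u := le_lt_trans s0_ge0 su.
    have := W'_le u u0; have := f_gt u (ltW su); nra.
  have := hderiv_le (hderivD dW dlin) s0_ge0 st1 H; rewrite /t1 mulrDr [X in _ + (_ + X)]mulrC divfK ?gt_eqF //.
  by have := W_ge0 t1 (le_trans s0_ge0 st1); rewrite /t1; lra.
near=> t; have st : s1 <= t by near: t; exact: nbhs_pinfty_ge (num_real _).
have s1_ge0 : 0 <= s1 := le_trans s0_ge0 s01.
have t_ge0 : 0 <= t := le_trans s1_ge0 st.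
rewrite ger0_norm ?f_ge0 //.
have dsum := hderivD df (hderivM (hderiv_cst kappa) dW).
have H u : s1 < u -> f' u + (0 * W u + kappa * W' u) <= 0.
  by move=> su; rewrite mul0r add0r fW' // (le_lt_trans s1_ge0).
have le_sum := hderiv_le dsum s1_ge0 st H.
have Wl := Wlb t t_ge0; have Ws1 := Wmono s0 s1 s0_ge0 s01.
have kW : kappa * (W s1 - W t) <= e / 2.
  have : W s1 - W t <= e / (2 * kappa) by lra.
  move=> /(ler_wpM2l (ltW kappa0)) H1; apply: le_trans H1 _.
  rewrite (_ : kappa * (e / (2 * kappa)) = e / 2) //; field; rewrite gt_eqF //.
lra.
Unshelve. all: by end_near.
Qed.

(** The filter commutes with d/dt.  The difference gap between the derivative of the
    first N columns of y and its last N columns solves the linear equation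
    gap' = Ap gap with gap(0) = 0. *)
Lemma filter_bank_state (R : realType) (np k N : nat) (Ap : 'M[R]_np) (Bp : 'M[R]_(np, k))
    (K : R -> 'M[R]_(k, N.+1)) (y : R -> 'M[R]_(np, N.+1)) :
  mderiv (fun t => K t *m (init_rows N)^T) (fun t => K t *m (tail_rows N)^T) ->
  K 0 *m (init_rows N)^T = 0 ->
  mderiv y (fun t => Ap *m y t + Bp *m K t) -> y 0 = 0 ->
  mderiv (fun t => y t *m (init_rows N)^T) (fun t => y t *m (tail_rows N)^T).
Proof.
move=> dK K0 dy y0.
pose gap t := Ap *m (y t *m (init_rows N)^T) + Bp *m (K t *m (init_rows N)^T)
              - y t *m (tail_rows N)^T.
have dgap : mderiv gap (fun t => Ap *m gap t).
  have := mderivB (mderivD (mderiv_mull Ap (mderiv_mulr (init_rows N)^T dy))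
    (mderiv_mull Bp dK)) (mderiv_mulr (tail_rows N)^T dy).
  apply: mderiv_ext => // t _; rewrite /gap !mulmxBr !mulmxDr !mulmxDl !mulmxDr !mulmxA.
  by rewrite opprD addrA addrAC addrK.
have gap0 t : 0 <= t -> gap t = 0.
  move=> t0; apply: trmx_inj; rewrite trmx0.
  apply: (@mderiv_linear0 _ _ _ Ap^T (fun t => (gap t)^T)) => //.
    by apply: mderiv_ext (mderiv_tr dgap) => // u _; rewrite trmx_mul.
  by rewrite /gap K0 y0 !mul0mx !mulmx0 addr0 subrr trmx0.
apply: mderiv_ext (mderiv_mulr (init_rows N)^T dy) => // t t0.
apply/eqP; rewrite -subr_eq0 mulmxDl -!mulmxA.
by rewrite -/(gap t) gap0 // ltW.
Qed.

Lemma coupling_formE (R : realType) (n np : nat) (q s r : R) (X : 'M[R]_(np + np + n))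
    (Y : 'M[R]_np) (u1 u2 v1 v2 : 'cV[R]_np) (x y : 'cV[R]_n) :
  bform (X - block_mx (kron2 (sym2 q s r) Y) 0 0 0)
    (col_mx (col_mx u1 u2) x) (col_mx (col_mx v1 v2) y) =
  bform X (col_mx (col_mx u1 u2) x) (col_mx (col_mx v1 v2) y) -
  (q * bform Y u1 v1 + s * (bform Y u1 v2 + bform Y u2 v1) + r * bform Y u2 v2).
Proof.
rewrite bformDS bformNS bform_block bform_kron !mulmx0 !mul0mx.
have z00 : (0 : 'M[R]_1) ord0 ord0 = 0 by rewrite mxE.
by rewrite /bform !mulmx0 !mul0mx !z00 !addr0.
Qed.

(** V is the form Xc in (xi, x) plus the storage of delta weighted by S, and xi
    gathers the states of the two filters.  In V' the terms in Y combine with the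
    storage identity into the terms in P0 (x) M of the loop inequality; only the
    square of the spectral factor is left over, with the right sign. *)
Lemma loop_storage (R : realType) (n k np mp N : nat)
    (A : 'M[R]_n) (B : 'M[R]_(n, k)) (C : 'M[R]_(k, n)) (D : 'M[R]_k) (q s r : R)
    (Ap : 'M[R]_np) (Bp : 'M[R]_(np, k)) (Cp : 'M[R]_(mp, np)) (Dp : 'M[R]_(mp, k))
    (X : 'M[R]_(np + np + n)) (Y : 'M[R]_np) (M : 'M[R]_mp)
    (Delta : lti R k k) (a b : {poly R}) (x : R -> 'cV[R]_n) (K : R -> 'M[R]_(k, N.+1))
    (Xc := X - block_mx (kron2 (sym2 q s r) Y) 0 0 0) :
  r <= 0 -> Y^T = Y -> M^T = M -> posdef (filter_form Ap Bp Cp Dp Y M) ->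
  scalar_realization q s r Delta N a b ->
  mcont K ->
  mderiv (fun t => K t *m (init_rows N)^T) (fun t => K t *m (tail_rows N)^T) ->
  K 0 *m (init_rows N)^T = 0 ->
  mderiv x (fun t => A *m x t + B *m (K t *m coef_col N b)) ->
  (forall t, 0 <= t -> K t *m coef_col N a = C *m x t + D *m (K t *m coef_col N b)) ->
  exists V V' : R -> R, exists xi : R -> 'cV[R]_(np + np),
    [/\ hderiv V V',
        forall t, 0 < t -> V' t <= bform (loop_form A B C D q s r Ap Bp Cp Dp X M)
          (col_mx (col_mx (xi t) (x t)) (K t *m coef_col N b))
          (col_mx (col_mx (xi t) (x t)) (K t *m coef_col N b)),
        forall t, 0 <= t -> bform Xc (col_mx (xi t) (x t)) (col_mx (xi t) (x t)) <= V t &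
        V 0 = bform Xc (col_mx 0 (x 0)) (col_mx 0 (x 0))].
Proof.
move=> r_le0 Ysym Msym Spos sr Kc dK K0 dx zE.
have a_monic := sr_monic sr; have sa := sr_size_den sr.
have sa' : (size a <= N.+1)%N by rewrite sa.
have [m sm factor] := para_form_factor sa' (sr_size_num sr) (sr_freq sr).
have [beta kyp] := kyp_identity sa' (sr_size_num sr) sm factor.
set S := filter_form Ap Bp Cp Dp Y M in Spos.
have [y dy y0] := variation_of_constants Ap (mcontM (mcont_cst Bp) Kc).
have dyi := filter_bank_state dK K0 dy y0.
pose G t := col_mx (y t) (K t).
pose Z t := G t *m (init_rows N)^T.
have dZ : mderiv Z (fun t => G t *m (tail_rows N)^T).
  by apply: mderiv_ext (mderiv_col_mx dyi dK) => t _; rewrite /Z /G mul_col_mx.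
have dV2 := hderiv_storage Spos.1 kyp (fun t _ => erefl (Z t)) dZ.
have dfilter (p : {poly R}) : mderiv (fun t => y t *m coef_col N p)
    (fun t => Ap *m (y t *m coef_col N p) + Bp *m (K t *m coef_col N p)).
  by apply: mderiv_ext (mderiv_mulr (coef_col N p) dy) => // t _; rewrite mulmxDl !mulmxA.
pose xi t := col_mx (y t *m coef_col N a) (y t *m coef_col N b).
pose u t := col_mx (xi t) (x t).
have du := mderiv_col_mx (mderiv_col_mx (dfilter a) (dfilter b)) dx.
have dV1 := hderiv_bform Xc du.
exists (fun t => bform Xc (u t) (u t) + storage S beta (Z t)).
eexists; exists xi; split.
- exact: (hderivD dV1 dV2).
- move=> t t0 /=; rewrite /xi /G !mul_col_mx loop_formE -zE ?(ltW t0) //.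
  set xi1 := y t *m coef_col N a; set xi2 := y t *m coef_col N b.
  set z := K t *m coef_col N a; set w := K t *m coef_col N b.
  have := bform_ge0 (col_mx (y t *m coef_col N m) (K t *m coef_col N m)) Spos.
  set sm2 := bform S (col_mx (y t *m coef_col N m) _) _ => sm2_ge0.
  rewrite !coupling_formE !filter_formE.
  rewrite [bform Y (Ap *m xi2 + Bp *m w) xi1]bformC //.
  rewrite [bform M (Cp *m xi2 + Dp *m w) (Cp *m xi1 + Dp *m z)]bformC //.
  rewrite [bform Y (Ap *m xi1 + Bp *m z) xi2]bformC //.
  rewrite -subr_ge0; move: sm2_ge0; congr (0 <= _).
  by ring.
- move=> t t0; rewrite lerDl; exact: (storage_ge0 _ r_le0 Spos a_monic sa (sr_stable sr) kyp).
- rewrite /u /xi /Z /G y0 !mul0mx col_mx0 mul_col_mx K0 mul0mx col_mx0.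
  by rewrite /storage !mulmx0 !mul0mx mxtrace0 addr0.
Qed.

Lemma enorm_sqr (R : realType) (n : nat) (u : 'cV[R]_n) : enorm u = Num.sqrt (sqnorm u).
Proof. by []. Qed.

Lemma cvg_sqnorm0 (R : realType) (n : nat) (x : R -> 'cV[R]_n) :
  sqnorm (x t) @[t --> +oo] --> (0 : R) -> x t @[t --> +oo] --> (0 : 'cV[R]_n).
Proof.
move=> sx; apply/cvg_ballP => e e0.
have ee0 : 0 < e ^+ 2 by rewrite exprn_gt0.
move/cvgr0Pnorm_lt: sx => /(_ _ ee0); apply: filterS => t xt; split=> // i j.
rewrite ord1 mxE /ball /= sub0r normrN -ltr_sqr ?nnegrE ?normr_ge0 ?(ltW e0) //.
rewrite real_normK ?num_real // (le_lt_trans (sqnorm_entry _ _)) //.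
exact: le_lt_trans (ler_norm _) xt.
Qed.

(** The derivative 2 x^T (A x + B w), as a quadratic form in (x, w). *)
Lemma hderiv_sqnorm (R : realType) (n k : nat) (A : 'M[R]_n) (B : 'M[R]_(n, k))
    (x : R -> 'cV[R]_n) (w : R -> 'cV[R]_k) :
  mderiv x (fun t => A *m x t + B *m w t) ->
  hderiv (fun t => sqnorm (x t))
    (fun t => bform (block_mx (A + A) (B + B) 0 0) (col_mx (x t) (w t)) (col_mx (x t) (w t))).
Proof.
move=> dx; apply: hderiv_ext (hderiv_bform 1%:M dx) => t _.
  by rewrite /bform mulmx1 mxE /sqnorm; apply: eq_bigr => i _; rewrite !mxE.
rewrite bformC ?trmx1 // bform_block /bform !mulmx0 !mul0mx !mulmx1.
have z00 : (0 : 'M[R]_1) ord0 ord0 = 0 by rewrite mxE.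
have E (M1 M2 : 'M[R]_1) : (M1 + M2) ord0 ord0 = M1 ord0 ord0 + M2 ord0 ord0 by rewrite mxE.
by rewrite !z00 !(mulmxDr, mulmxDl) -!mulmxA !E; ring.
Qed.

Lemma stability_bound (R : realType) (n k np mp : nat)
    (A : 'M[R]_n) (B : 'M[R]_(n, k)) (C : 'M[R]_(k, n)) (D : 'M[R]_k) (q s r : R)
    (Ap : 'M[R]_np) (Bp : 'M[R]_(np, k)) (Cp : 'M[R]_(mp, np)) (Dp : 'M[R]_(mp, k))
    (X : 'M[R]_(np + np + n)) (Y : 'M[R]_np) (M : 'M[R]_mp) :
  r <= 0 -> Y^T = Y -> M^T = M -> posdef (filter_form Ap Bp Cp Dp Y M) ->
  negdef (loop_form A B C D q s r Ap Bp Cp Dp X M) ->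
  posdef (X - block_mx (kron2 (sym2 q s r) Y) 0 0 0) ->
  exists2 M0 : R, 0 < M0 &
    forall Delta : lti R k k, uncertainties (repeated_scalars k (sym2 q s r)) Delta ->
    forall x : R -> 'cV[R]_n, trajectory A B C D Delta x ->
      (x t @[t --> +oo] --> (0 : 'cV[R]_n)) /\
      forall t : R, 0 <= t -> enorm (x t) <= M0 * enorm (x 0).
Proof.
move=> r_le0 Ysym Msym Spos Lneg Xpos; set Xc := _ - _ in Xpos.
have [c c0 Xge] := posdef_ge Xpos.
have [c1 c1_0 Xle] := bform_le Xc.
have [eps eps0 Lge] := posdef_ge Lneg.
pose Q : 'M[R]_(n + k) := block_mx (A + A) (B + B) 0 0.
have [c2 c2_0 Qle] := bform_le Q.
exists (Num.sqrt (c1 / c)); first by rewrite sqrtr_gt0 divr_gt0.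
move=> Delta unc x traj.
have [N [a [b sr]]] := uncertainty_realization r_le0 unc.
have wp : \det (1%:M - b`_N *: D) != 0.
  have inV : repeated_scalars k (sym2 q s r) (Complex b`_N 0)%:M.
    apply/repeated_scalarsP; exists b`_N, 0; split=> //.
    by rewrite expr0n addr0; exact: sr_infty sr.
  have := lmi_well_posed Msym Spos Lneg inV.
  have -> : 1%:M - cmx D *m (Complex b`_N 0)%:M = map_mx (real_complex R) (1%:M - b`_N *: D).
    by rewrite map_mxB map_mx1 map_mxZ mul_mx_scalar.
  by rewrite det_map_mx fmorph_eq0.
have [K [Kc dK K0 dx zE]] := trajectory_ode sr wp traj.
have [V [V' [xi [dV V'le Vge V0]]]] :=
  loop_storage X r_le0 Ysym Msym Spos sr Kc dK K0 dx zE.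
pose w t := K t *m coef_col N b.
have V_ge t : 0 <= t -> c * sqnorm (x t) <= V t.
  move=> t0; apply: le_trans (Vge t t0); apply: le_trans (Xge _).
  by rewrite ler_wpM2l ?(ltW c0) // sqnorm_col_mx lerDr sqnorm_ge0.
have V'_le t : 0 < t -> V' t <= - eps * (sqnorm (x t) + sqnorm (w t)).
  move=> t0; apply: le_trans (V'le t t0) _.
  have := Lge (col_mx (col_mx (xi t) (x t)) (w t)); rewrite bformNS => H.
  rewrite mulNr lerNr; apply: le_trans H; rewrite ler_wpM2l ?(ltW eps0) //.
  by rewrite !sqnorm_col_mx lerD2r lerDr sqnorm_ge0.
have Vmono t : 0 <= t -> V t <= V 0.
  move=> t0; apply: (hderiv_le dV) => // u u0; apply: le_trans (V'_le u u0) _.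
  by rewrite mulNr oppr_le0 mulr_ge0 ?(ltW eps0) ?addr_ge0 ?sqnorm_ge0.
have V0_le : V 0 <= c1 * sqnorm (x 0).
  by rewrite V0 (le_trans (Xle _)) // sqnorm_col_mx sqnorm0 add0r.
split; last first.
  move=> t t0; rewrite !enorm_sqr -sqrtrM ?divr_ge0 ?(ltW c0) ?(ltW c1_0) //.
  rewrite ler_wsqrtr // mulrAC ler_pdivlMr // mulrC.
  exact: le_trans (V_ge t t0) (le_trans (Vmono t t0) V0_le).
apply: cvg_sqnorm0.
have dn := hderiv_sqnorm dx.
apply: (@dissipated_cvg0 R _ _ V V' eps (c2 / eps) eps0 _ dn dV).
- by rewrite divr_gt0.
- by move=> t _; exact: sqnorm_ge0.
- by move=> t t0; apply: le_trans (V_ge t t0); rewrite mulr_ge0 ?sqnorm_ge0 ?(ltW c0).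
- move=> t t0; apply: le_trans (V'_le t t0) _.
  by rewrite !mulNr lerN2 ler_wpM2l ?(ltW eps0) // lerDl sqnorm_ge0.
- move=> t t0; have := Qle (col_mx (x t) (w t)); rewrite sqnorm_col_mx.
  have := ler_wpM2l (divr_ge0 (ltW c2_0) (ltW eps0)) (V'_le t t0).
  set p := sqnorm _ + _; rewrite mulNr mulrN mulrA divfK ?gt_eqF // => H1 H2.
  by rewrite (le_trans (lerD H2 H1)) // subrr.
Qed.

Theorem theorem6 (R : realType) (n k np mp : nat)
    (A : 'M[R]_n) (B : 'M[R]_(n, k)) (C : 'M[R]_(k, n)) (D : 'M[R]_k)
    (q s r : R) (hr : r <= 0)
    (Ap : 'M[R]_np) (Bp : 'M[R]_(np, k)) (Cp : 'M[R]_(mp, np))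
    (Dp : 'M[R]_(mp, k)) (hAp : hurwitz Ap)
    (X : 'M[R]_(np + np + n)) (Y : 'M[R]_np) (M : 'M[R]_mp)
    (hX : X^T = X) (hY : Y^T = Y) (hM : M^T = M)
    (lmi_pos :
      posdef ((col_mx (row_mx 1%:M 0) (row_mx Ap Bp))^T
                *m block_mx 0 Y Y 0
                *m col_mx (row_mx 1%:M 0) (row_mx Ap Bp)
              + (row_mx Cp Dp)^T *m M *m row_mx Cp Dp))
    (lmi_neg :
      negdef ((lmi_H A B C D Ap Bp Cp Dp)^T
                *m block_mx (block_mx 0 X X 0) 0 0 (kron2 (sym2 q s r) M)
                *m lmi_H A B C D Ap Bp Cp Dp))
    (lmi_coupling :
      posdef (X - block_mx (kron2 (sym2 q s r) Y) 0 0 0)) :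
  robustly_stable A B C D (repeated_scalars k (sym2 q s r)).

Proof.
split; first by move=> W; exact: lmi_well_posed hM lmi_pos lmi_neg.
have [M0 M0_gt0 bound] := stability_bound hr hY hM lmi_pos lmi_neg lmi_coupling.
by exists M0.
Qed.
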